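(* Let $V$ be a T-type weak quantum vertex algebra, let $G$ be an automorphism group of $V$ equipped with a linear character $\chi:G\to\mathbb{C}^{\times}$, and let $(W,Y_W)$ be a $G$-covariant $\phi$-coordinated quasi $V$-module. Suppose that $u,v\in V$, $u^{(i)},v^{(i)}\in V$, $f_i(x)\in\mathbb{C}(x)$ $(i=1,\dots,r)$ are such that $$(x_1-x_2)^kY(u,x_1)Y(v,x_2)=(x_1-x_2)^k\sum_{i=1}^r\iota_{x_2,x_1}\big(f_i(e^{x_1-x_2})\big)Y(v^{(i)},x_2)Y(u^{(i)},x_1)$$ for some nonnegative integer $k$. Then there are finitely many $g_1,\dots,g_n\in G$ with $\chi(g_1),\dots,\chi(g_n)$ distinct such that $$Y_W(u,x_1)Y_W(v,x)-\sum_{i=1}^r\iota_{x,x_1}\big(f_i(x_1/x)\big)Y_W(v^{(i)},x)Y_W(u^{(i)},x_1)=\mathrm{Res}_{x_0}\sum_{j=1}^nY_W(Y(g_ju,x_0)v,x)\,e^{x_0\left(x\frac{\partial}{\partial x}\right)}\delta\left(\frac{\chi(g_j)x}{x_1}\right).$$ Furthermore, if $\chi:G\to\mathbb{C}^{\times}$ is injective, then $$Y_W(u,x_1)Y_W(v,x)-\sum_{i=1}^r\iota_{x,x_1}\big(f_i(x_1/x)\big)Y_W(v^{(i)},x)Y_W(u^{(i)},x_1)=\mathrm{Res}_{x_0}\sum_{g\in G}Y_W(Y(gu,x_0)v,x)\,e^{x_0\left(x\frac{\partial}{\partial x}\right)}\delta\left(\frac{\chi(g)x}{x_1}\right),$$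 where the sum on the right is a finite sum (only finitely many $g$ contribute a nonzero term).
   Context: All vector spaces are over $\mathbb{C}$; $x,z,x_0,x_1,x_2,\dots$ are commuting formal variables. $U((x))$ is the space of lower truncated formal Laurent series; $U((x_1))((x_2))$ means Laurent series in $x_2$ with coefficients in $U((x_1))$; $U((x_1,x_2))=U[[x_1,x_2]][x_1^{-1},x_2^{-1}]$. $\mathrm{Hom}(W,W((x_1,x_2)))$ is regarded as a subspace of $(\mathrm{End}\,W)[[x_1^{\pm1},x_2^{\pm1}]]$. $\iota_{x_1,x_2}$ is the canonical embedding of the fraction field of $\mathbb{C}[[x_1,x_2]]$ into $\mathbb{C}((x_1))((x_2))$; so $\iota_{x_2,x_1}$ and $\iota_{x,x_1}$ land in $\mathbb{C}((x_2))((x_1))$ and $\mathbb{C}((x))((x_1))$. Powers $(x_1-x_2)^n$, $n\in\mathbb{Z}$, are expanded in nonnegative powers of the second term. $\delta(x)=\sum_{n\in\mathbb{Z}}x^n$. $\mathrm{Res}_{x_0}$ takes the coefficient of $x_0^{-1}$. The operator $e^{x_0(x\partial/\partial x)}$ acts only on the delta function. For $g(x)=p(x)/q(x)\in\mathbb{C}(x)$, $g(e^x)=p(e^x)/q(e^x)\in\mathbb{C}((x))$. Weak quantum vertex algebra: a vector space $V$ with a linear map $Y(\cdot,x):V\to\mathrm{Hom}(V,V((x)))$, $v\mapsto Y(v,x)=\sum_{n\in\mathbb{Z}}v_nx^{-n-1}$, and a vector $\mathbf 1\in V$ such that $Y(\mathbf 1,x)v=v$, $Y(v,x)\mathbf 1\in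 V[[x]]$, $\lim_{x\to0}Y(v,x)\mathbf 1=v$ for $v\in V$, and for $u,v\in V$ there exist $u^{(i)},v^{(i)}\in V$, $f_i(x)\in\mathbb{C}((x))$ $(i=1,\dots,r)$ with $$x_0^{-1}\delta\Big(\tfrac{x_1-x_2}{x_0}\Big)Y(u,x_1)Y(v,x_2)-x_0^{-1}\delta\Big(\tfrac{x_2-x_1}{-x_0}\Big)\sum_{i=1}^rf_i(x_2-x_1)Y(v^{(i)},x_2)Y(u^{(i)},x_1)=x_2^{-1}\delta\Big(\tfrac{x_1-x_0}{x_2}\Big)Y(Y(u,x_0)v,x_2).$$ An automorphism of $V$ is a bijective linear map $\sigma$ with $\sigma(\mathbf 1)=\mathbf 1$ and $\sigma(Y(u,x)v)=Y(\sigma u,x)\sigma v$ for $u,v\in V$. T-type: $V$ is of T-type if for any $u,v\in V$ there exist $u^{(i)},v^{(i)}\in V$, $f_i(x)\in\mathbb{C}(x)$ $(i=1,\dots,r)$ and $k\in\mathbb{N}$ with $(x_1-x_2)^kY(u,x_1)Y(v,x_2)=(x_1-x_2)^k\sum_{i}\iota_{x_2,x_1}(f_i(e^{x_1-x_2}))Y(v^{(i)},x_2)Y(u^{(i)},x_1)$. $\phi$-coordinated quasi $V$-module (with $\phi(x,z)=xe^z$): a vector space $W$ with a linear map $Y_W(\cdot,x):V\to\mathrm{Hom}(W,W((x)))$ such that $Y_W(\mathbf 1,x)=1_W$ and for $u,v\in V$ there is a nonzero polynomial $p(x)$ with $p(x_1/x_2)Y_W(u,x_1)Y_W(v,x_2)\in\mathrm{Hom}(W,W((x_1,x_2)))$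 and $p(e^z)Y_W(Y(u,z)v,x_2)=\big(p(x_1/x_2)Y_W(u,x_1)Y_W(v,x_2)\big)|_{x_1=x_2e^z}$. $G$-covariant $\phi$-coordinated quasi $V$-module (for a T-type $V$, a group $G$ of automorphisms of $V$, and a linear character $\chi:G\to\mathbb{C}^\times$): a $\phi$-coordinated quasi $V$-module $(W,Y_W)$ such that $Y_W(gv,x)=Y_W(v,\chi(g)x)$ for $g\in G$, $v\in V$, and for $u,v\in V$ there exists a nonzero $p(x)\in\mathbb{C}[x]$ with zeroes only in $\chi(G)$ such that $p(x_1/x_2)Y_W(u,x_1)Y_W(v,x_2)\in\mathrm{Hom}(W,W((x_1,x_2)))$. *)

(* Defs.v *)
From HB Require Import structures.
From mathcomp Require Export all_boot all_order all_algebra.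
From mathcomp Require Export generic_quotient fraction complex.
From mathcomp Require Export boolp classical_sets functions cardinality fsbigop.
From mathcomp Require Export reals.

Set Implicit Arguments.
Unset Strict Implicit.
Unset Printing Implicit Defensive.

Export Order.TTheory GRing.Theory Num.Theory.
Global Open Scope classical_set_scope.
Global Open Scope ring_scope.

(** A formal series in k variables with coefficients in [U] is the function
    sending an exponent (an element of [int], [int * int] or
    [int * int * int]) to the coefficient of that monomial.  Exponents of pairs
    and triples are listed in the order of the variables: (x1, x2), (x1, x),
    (z, x2), (x0, x1, x2) or (x0, x1, x). *)

Section FormalSeries.
Context {K : fieldType}.

(** The product of a scalar series and a vector series.  Each coefficient is a
    finitely supported sum for all the products used below; [fsbigop] returns
    0 otherwise. *)
Definition fmul (E : zmodType) (U : lmodType K) (a : E -> K) (A : E -> U) :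
    E -> U :=
  fun e => \sum_(d \in [set: E]) a d *: A (e - d).

Definition truncated (U : zmodType) (A : int -> U) : Prop :=
  exists N : int, forall n, n < N -> A n = 0.

(** A belongs to U((x1, x2)) = U[[x1, x2]][x1^-1, x2^-1]. *)
Definition truncated2 (U : zmodType) (A : int * int -> U) : Prop :=
  exists N : int, forall a b, (a < N) || (b < N) -> A (a, b) = 0.

(** h belongs to K((x2))((x1)), exponents being those of (x1, x2). *)
Definition laurent21 (h : int * int -> K) : Prop :=
  (exists N : int, forall a b, a < N -> h (a, b) = 0) /\
  (forall a, truncated (fun b => h (a, b))).

Definition binz (n : int) (i : nat) : K :=
  (\prod_(j < i) (n - j%:Z)%:~R) / i`!%:R.

(** (y - z)^n, expanded in nonnegative powers of z; exponents of (y, z). *)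
Definition binexp (n : int) : int * int -> K := fun '(a, b) =>
  if b is Posz i then
    if a + b == n then (-1) ^+ i * binz n i else 0
  else 0.

(** f(y - z) = \sum_n f_n (y - z)^n for f in K((x)); exponents of (y, z). *)
Definition at_diff (f : int -> K) : int * int -> K := fun '(a, b) =>
  f (a + b) * binexp (a + b) (a, b).

Definition swap (U : Type) (A : int * int -> U) : int * int -> U :=
  fun '(a, b) => A (b, a).

(** A series in (x1, x2), resp. in (x0, x2), as a series in (x0, x1, x2). *)
Definition lift12 (U : zmodType) (A : int * int -> U) : int * int * int -> U :=
  fun '(c, a, b) => if c == 0 then A (a, b) else 0.
Definition lift02 (U : zmodType) (A : int * int -> U) : int * int * int -> U :=
  fun '(c, a, b) => if a == 0 then A (c, b) else 0.

(** A scalar series in z as a series in (z, x2). *)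
Definition lift1 (f : int -> K) : int * int -> K :=
  fun '(a, b) => if b == 0 then f a else 0.

(** x0^-1 delta((x1 - x2) / x0) = \sum_n x0^(-n-1) (x1 - x2)^n. *)
Definition delta_12_0 : int * int * int -> K := fun '(c, a, b) =>
  binexp (- c - 1) (a, b).

(** x0^-1 delta((x2 - x1) / (- x0))
      = \sum_n (-1)^n x0^(-n-1) (x2 - x1)^n. *)
Definition delta_21_0 : int * int * int -> K := fun '(c, a, b) =>
  (-1) ^ (- c - 1) * binexp (- c - 1) (b, a).

(** x2^-1 delta((x1 - x0) / x2) = \sum_n x2^(-n-1) (x1 - x0)^n. *)
Definition delta_10_2 : int * int * int -> K := fun '(c, a, b) =>
  binexp (- b - 1) (a, c).

(** e^(c x). *)
Definition fexp (c : K) : int -> K := fun n =>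
  if n is Posz m then c ^+ m / m`!%:R else 0.

(** p(e^x). *)
Definition poly_exp (p : {poly K}) : int -> K := fun n =>
  \sum_(k < size p) p`_k * fexp k%:R n.

(** p(x1 / x2). *)
Definition poly_ratio (p : {poly K}) : int * int -> K := fun '(a, b) =>
  if a is Posz k then (if a + b == 0 then p`_k else 0) else 0.

(** A(x1, x2) at x1 = x2 e^z, as a series in (z, x2); meant for A in
    U((x1, x2)). *)
Definition subst_exp (U : lmodType K) (A : int * int -> U) : int * int -> U :=
  fun '(m, c) => \sum_(a \in [set: int]) fexp a%:~R m *: A (a, c - a).

(** iota_{x2,x1}(P / Q): the image of the fraction P / Q in the field
    K((x2))((x1)), i.e. the unique H there with Q H = P. *)
Definition iota21 (P Q : int * int -> K) : int * int -> K :=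
  xget (fun=> 0)
    [set H | laurent21 H /\ fmul (U := K^o) Q H = P].

(** A numerator and a (nonzero) denominator of a rational function. *)
Definition fnum (f : {fraction {poly K}}) : {poly K} :=
  let r : {ratio {poly K}} := repr f in \n_r.
Definition fden (f : {fraction {poly K}}) : {poly K} :=
  let r : {ratio {poly K}} := repr f in \d_r.

(** iota_{x2,x1}(f(e^(x1 - x2))). *)
Definition iota_exp (f : {fraction {poly K}}) : int * int -> K :=
  iota21 (at_diff (poly_exp (fnum f))) (at_diff (poly_exp (fden f))).

(** iota_{x2,x1}(f(x1 / x2)). *)
Definition iota_ratio (f : {fraction {poly K}}) : int * int -> K :=
  iota21 (poly_ratio (fnum f)) (poly_ratio (fden f)).

(** delta(c x / x1), with exponents of (x1, x). *)
Definition delta_ratio (c : K) : int * int -> K := fun '(a, b) =>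
  if a + b == 0 then c ^ b else 0.

(** x d/dx on series in (x1, x). *)
Definition xddx (A : int * int -> K) : int * int -> K := fun '(a, b) =>
  b%:~R * A (a, b).

(** e^(x0 (x d/dx)) A, with exponents of (x0, x1, x). *)
Definition exp_xddx (A : int * int -> K) : int * int * int -> K :=
  fun '(c, a, b) =>
    if c is Posz s then iter s xddx A (a, b) / s`!%:R else 0.

Definition Res0 (U : Type) (A : int * int * int -> U) : int * int -> U :=
  fun '(a, b) => A (-1, a, b).

End FormalSeries.

Section VertexAlgebra.
Context {K : fieldType}.
Implicit Types V W : lmodType K.

(** A map Y(.,x) : V -> Hom(W, W((x))) is given by [Y v w : int -> W], the
    series Y(v,x)w; thus v_n w = [Y v w (- n - 1)]. *)

Definition vertex_map V W (Y : V -> W -> int -> W) : Prop :=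
  [/\ forall w n, linear (fun v => Y v w n),
      forall v n, linear (fun w => Y v w n)
    & forall v w, truncated (Y v w)].

(** Y(u,x1) Y(v,x2) w, with exponents of (x1, x2); Y(v,x2) Y(u,x1) w is
    [swap (YY Y v u w)]. *)
Definition YY V W (Y : V -> W -> int -> W) (u v : V) (w : W) :
    int * int -> W :=
  fun '(a, b) => Y u (Y v w b) a.

(** Y_W(Y(u,x0)v,x2) w, with exponents of (x0, x2). *)
Definition Yiter V W (Y : V -> V -> int -> V) (YW : V -> W -> int -> W)
    (u v : V) (w : W) : int * int -> W :=
  fun '(c, b) => YW (Y u v c) w b.

Record weak_quantum_va V (one : V) (Y : V -> V -> int -> V) : Prop := {
  wqva_map : vertex_map Y;
  wqva_one : forall v n, Y one v n = if n == 0 then v else 0;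
  wqva_creation : forall v n, n < 0 -> Y v one n = 0;
  wqva_limit : forall v, Y v one 0 = v;
  wqva_jacobi : forall u v, exists (r : nat) (u' v' : 'I_r -> V)
      (f : 'I_r -> int -> K),
    (forall i, truncated (f i)) /\
    forall w e,
      fmul delta_12_0 (lift12 (YY Y u v w)) e
      - fmul delta_21_0 (lift12 (fun d =>
          \sum_(i < r)
            fmul (swap (at_diff (f i))) (swap (YY Y (v' i) (u' i) w)) d)) e
      = fmul delta_10_2 (lift02 (Yiter Y Y u v w)) e }.

(** (x1 - x2)^k Y(u,x1) Y(v,x2) = (x1 - x2)^k
      \sum_i iota_{x2,x1}(f_i(e^(x1-x2))) Y(v_i,x2) Y(u_i,x1). *)
Definition T_relation V (Y : V -> V -> int -> V) (u v : V) (r : nat)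
    (u' v' : 'I_r -> V) (f : 'I_r -> {fraction {poly K}}) (k : nat) : Prop :=
  forall w e,
    fmul (binexp k) (YY Y u v w) e
    = fmul (binexp k) (fun d =>
        \sum_(i < r)
          fmul (iota_exp (f i)) (swap (YY Y (v' i) (u' i) w)) d) e.

Definition T_type V (Y : V -> V -> int -> V) : Prop :=
  forall u v, exists (r : nat) (u' v' : 'I_r -> V)
    (f : 'I_r -> {fraction {poly K}}) (k : nat), T_relation Y u v u' v' f k.

Record automorphism V (one : V) (Y : V -> V -> int -> V) (s : V -> V) :
    Prop := {
  aut_linear : linear s;
  aut_bij : bijective s;
  aut_one : s one = one;
  aut_Y : forall u v n, s (Y u v n) = Y (s u) (s v) n }.

(** A subgroup of the group of all automorphisms. *)
Record automorphism_group V (one : V) (Y : V -> V -> int -> V)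
    (G : set (V -> V)) : Prop := {
  autg_sub : forall g, G g -> automorphism one Y g;
  autg_id : G id;
  autg_comp : forall g h, G g -> G h -> G (g \o h);
  autg_inv : forall g, G g -> exists h, [/\ G h, cancel g h & cancel h g] }.

(** A group homomorphism from G to the nonzero scalars; the values of [chi]
    outside G are irrelevant. *)
Record linear_character V (G : set (V -> V)) (chi : (V -> V) -> K) : Prop := {
  chi_neq0 : forall g, G g -> chi g != 0;
  chi_comp : forall g h, G g -> G h -> chi (g \o h) = chi g * chi h }.

(** p(x1 / x2) Y_W(u,x1) Y_W(v,x2) w. *)
Definition pYY V W (YW : V -> W -> int -> W) (p : {poly K}) (u v : V) (w : W) :
    int * int -> W :=
  fmul (poly_ratio p) (YY YW u v w).

Record phi_quasi_module V W (one : V) (Y : V -> V -> int -> V)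
    (YW : V -> W -> int -> W) : Prop := {
  phim_map : vertex_map YW;
  phim_one : forall w n, YW one w n = if n == 0 then w else 0;
  phim_assoc : forall u v, exists p : {poly K},
    [/\ p != 0,
        forall w, truncated2 (pYY YW p u v w)
      & forall w e,
          fmul (lift1 (poly_exp p)) (Yiter Y YW u v w) e
          = subst_exp (pYY YW p u v w) e] }.

Record covariant_phi_quasi_module V W (one : V) (Y : V -> V -> int -> V)
    (G : set (V -> V)) (chi : (V -> V) -> K) (YW : V -> W -> int -> W) :
    Prop := {
  cov_module : phi_quasi_module one Y YW;
  cov_Y : forall g v w n, G g -> YW (g v) w n = chi g ^ n *: YW v w n;
  cov_zeros : forall u v, exists p : {poly K},
    [/\ p != 0,
        forall z, root p z -> exists2 g, G g & chi g = z
      & forall w, truncated2 (pYY YW p u v w)] }.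

(** Y_W(u,x1) Y_W(v,x) w
      - \sum_i iota_{x,x1}(f_i(x1/x)) Y_W(v_i,x) Y_W(u_i,x1) w. *)
Definition commutator_lhs V W (YW : V -> W -> int -> W) (u v : V) (r : nat)
    (u' v' : 'I_r -> V) (f : 'I_r -> {fraction {poly K}}) (w : W) :
    int * int -> W :=
  fun e => YY YW u v w e
    - \sum_(i < r) fmul (iota_ratio (f i)) (swap (YY YW (v' i) (u' i) w)) e.

(** Y_W(Y(g u,x0)v,x) e^(x0 (x d/dx)) delta(chi(g) x / x1) w, with exponents of
    (x0, x1, x). *)
Definition commutator_term V W (Y : V -> V -> int -> V)
    (YW : V -> W -> int -> W) (chi : (V -> V) -> K) (u v : V) (g : V -> V)
    (w : W) : int * int * int -> W :=
  fmul (exp_xddx (delta_ratio (chi g))) (lift02 (Yiter Y YW (g u) v w)).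

End VertexAlgebra.

(* Main.v *)
From HB Require Import structures.
From mathcomp Require Import all_boot all_order all_algebra.
From mathcomp Require Import zify ring ssrAC.
From mathcomp Require Import boolp classical_sets functions cardinality fsbigop.
Require Import Defs.

(** In each total degree d, with t = x1 / x, the product Y_W(u,x1) Y_W(v,x)w is
    a series A(t) in t^-1, the sum S(t) of the iota_{x,x1}(f_i(x1/x)) times the
    products in the other order is a series in t, and
    F(z) = Y_W(Y(u,z)v,x)w is a Laurent series in z.  The module axiom says that
    A and F are expansions of one rational function P(t) / p(t), at t = oo and
    along t = e^z; skew symmetry, which the T-type relation implies when it is
    applied to the vacuum, says the same of S and F.  Hence p A = p S = P, where
    by covariance p may be chosen with all its roots in chi(G), and A - S is the
    difference of the expansions of P / p at infinity and at zero: the sum of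
    the residues of t^(-a-1) P / p dt at the roots b of p.  With t = b e^z and
    b = chi(g) the expansion of P / p along t is F(z) for g u in place of u, so
    these residues are the terms on the right-hand side. *)

Set Implicit Arguments.
Unset Strict Implicit.
Unset Printing Implicit Defensive.

(** * Polynomials in a linear operator *)

(** The quotient P / p never appears as an object: denominators stay cleared, and a polynomial in t
    acts through [poly_act] on series in t by the shift [tmul] and on series in z by multiplication
    with e^z. Three obstacles shape the argument. The polynomial of the module axiom may have zeros
    anywhere, while the one given by covariance comes without associativity; since multiplication by
    q(e^z) is injective, every p that makes p A finite has the same relation to F, so the second
    polynomial can replace the first. Skew symmetry should come from the vacuum relation at x2 = 0,
    but the expansions in K((x2))((x1)) may contain infinitely many negative powers of x2. Therefore
    x2 is first replaced by x1 - y, which turns f(e^(x1-x2)) into f(e^y) and lets its denominator be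
    cleared; only then is y = x1 imposed. Lastly, the residues are compared without partial
    fractions: the defect of the formula is killed by t - z for each root z of p, and an induction
    on the degree of p remains. *)

Section LinearMap.
Context {K : pzRingType} {U U' : lmodType K} {F : U -> U'} (hF : linear F).

Lemma lin0 : F 0 = 0.
Proof. by have := hF (-1) 0 0; rewrite scaler0 addr0 scaleN1r addNr. Qed.

Lemma linD x y : F (x + y) = F x + F y.
Proof. by have := hF 1 x y; rewrite !scale1r. Qed.

Lemma linZ c x : F (c *: x) = c *: F x.
Proof. by have := hF c x 0; rewrite lin0 !addr0. Qed.

Lemma linN x : F (- x) = - F x.
Proof. by rewrite -scaleN1r linZ scaleN1r. Qed.

Lemma linB x y : F (x - y) = F x - F y.
Proof. by rewrite linD linN. Qed.

Lemma lin_sum (I : Type) (r : seq I) (P : pred I) (G : I -> U) :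
  F (\sum_(i <- r | P i) G i) = \sum_(i <- r | P i) F (G i).
Proof. exact: (big_morph _ linD lin0). Qed.

End LinearMap.

Section PolyAction.
Context {K : closedFieldType} {U : lmodType K}.
Implicit Types (T : U -> U) (p q : {poly K}) (u : U).

Definition poly_act T p u : U := \sum_(k < size p) p`_k *: iter k T u.

Lemma poly_act_widen T p u n : (size p <= n)%N ->
  poly_act T p u = \sum_(k < n) p`_k *: iter k T u.
Proof.
move=> hn; rewrite /poly_act (big_ord_widen n (fun k => p`_k *: iter k T u)) //.
rewrite big_mkcond; apply: eq_bigr => k _; case: ltnP => // hk.
by rewrite nth_default ?scale0r.
Qed.

Lemma poly_actC T c u : poly_act T c%:P u = c *: u.
Proof. by rewrite (poly_act_widen _ _ (size_polyC_leq1 c)) big_ord1 coefC. Qed.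

Lemma poly_actX T u : poly_act T 'X u = T u.
Proof. by rewrite /poly_act size_polyX !big_ord_recl big_ord0 !coefX scale0r add0r scale1r addr0.
  Qed.

Lemma poly_act_addp T p q u : poly_act T (p + q) u = poly_act T p u + poly_act T q u.
Proof.
rewrite (poly_act_widen _ _ (size_polyD p q)).
rewrite (@poly_act_widen T p u _ (leq_maxl _ (size q))).
rewrite (@poly_act_widen T q u _ (leq_maxr (size p) _)).
by rewrite -big_split /=; apply: eq_bigr => k _; rewrite coefD scalerDl.
Qed.

Lemma poly_act_scalep T c p u : poly_act T (c *: p) u = c *: poly_act T p u.
Proof.
rewrite (poly_act_widen _ _ (size_scale_leq c p)) scaler_sumr.
by apply: eq_bigr => k _; rewrite coefZ scalerA.
Qed.

Lemma poly_actXr T p u : poly_act T (p * 'X) u = poly_act T p (T u).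
Proof.
have hs : (size (p * 'X)%R <= (size p).+1)%N.
  by apply: leq_trans (size_polyMleq _ _) _; rewrite size_polyX addn2.
rewrite (poly_act_widen _ _ hs) big_ord_recl coefMX scale0r add0r.
by apply: eq_bigr => k _; rewrite coefMX /= -iterS iterSr.
Qed.

Lemma eq_poly_act T T' p u : T =1 T' -> poly_act T p u = poly_act T' p u.
Proof. by move=> h; apply: eq_bigr => k _; rewrite (eq_iter h). Qed.

Section Linear.
Context (T : U -> U) (hT : linear T).

Lemma iter_linear k : linear (iter k T).
Proof. by elim: k => [|k IH] c x y //=; rewrite IH hT. Qed.

Lemma poly_act_linear p : linear (poly_act T p).
Proof.
move=> c x y; rewrite /poly_act scaler_sumr -big_split; apply: eq_bigr => k _ /=.
by rewrite iter_linear scalerDr !scalerA mulrC.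
Qed.

Lemma poly_actD p x y : poly_act T p (x + y) = poly_act T p x + poly_act T p y.
Proof. exact: linD (poly_act_linear p) x y. Qed.

Lemma poly_act0 p : poly_act T p 0 = 0.
Proof. exact: lin0 (poly_act_linear p). Qed.

Lemma poly_actZ p c x : poly_act T p (c *: x) = c *: poly_act T p x.
Proof. exact: linZ (poly_act_linear p) c x. Qed.

Lemma poly_actB p x y : poly_act T p (x - y) = poly_act T p x - poly_act T p y.
Proof. exact: linB (poly_act_linear p) x y. Qed.

Lemma poly_act_sum (I : Type) (r : seq I) (P : pred I) (F : I -> U) p :
  poly_act T p (\sum_(i <- r | P i) F i) = \sum_(i <- r | P i) poly_act T p (F i).
Proof. exact: lin_sum (poly_act_linear p) _ _ _ _. Qed.

Lemma poly_actM p q u : poly_act T (p * q) u = poly_act T p (poly_act T q u).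
Proof.
elim/poly_ind: q u => [|q c IH] u; first by rewrite mulr0 !(poly_actC T 0) !scale0r poly_act0.
rewrite mulrDr mulrA !poly_act_addp !poly_actXr IH [p * c%:P]mulrC mul_polyC.
by rewrite poly_act_scalep poly_actD poly_actC poly_actZ.
Qed.

Lemma poly_actXsub b u : poly_act T ('X - b%:P) u = T u - b *: u.
Proof. by rewrite -polyCN poly_act_addp poly_actX poly_actC scaleNr. Qed.

End Linear.

(** One linear factor is split off at a time. The predicate [C] is there because [tmul] minus a
    nonzero scalar has a kernel on two-sided series and is injective only on series bounded on one
    side; for [expmul 1] it is trivial. *)
Lemma poly_act_inj T (C : U -> Prop) : linear T ->
  (forall b u, C u -> C (T u - b *: u)) ->
  (forall b u, C u -> T u = b *: u -> u = 0) ->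
  forall p u, p != 0 -> C u -> poly_act T p u = 0 -> u = 0.
Proof.
move=> hT hC hinj p u p0; have [n] := ubnP (size p); elim: n => // n IH in p p0 u *.
rewrite ltnS => hn Cu hp; have [s1|s1] := eqVneq (size p) 1%N.
  have /size_poly1P [c c0 pc] : size p == 1%N by apply/eqP.
  by move: hp; rewrite pc poly_actC => /eqP; rewrite scaler_eq0 (negPf c0) => /eqP.
have /closed_rootP [b /factor_theorem [q pq]] := s1.
have q0 : q != 0 by apply: contraNneq p0 => q0; rewrite pq q0 mul0r.
move: hn; rewrite pq size_Mmonic ?monicXsubC // size_XsubC addn2 /= => hn.
move: hp; rewrite pq (poly_actM hT) (poly_actXsub) => hp.
have /eqP := IH q q0 _ hn (hC b u Cu) hp.
by rewrite subr_eq0 => /eqP; apply: hinj.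
Qed.

End PolyAction.

Lemma poly_act_intertwine (K : closedFieldType) (U U' : lmodType K)
  (T : U -> U) (T' : U' -> U') (F : U' -> U) p u :
  linear F -> (forall x, F (T' x) = T (F x)) ->
  F (poly_act T' p u) = poly_act T p (F u).
Proof.
move=> linF hF; rewrite /poly_act (lin_sum linF); apply: eq_bigr => k _.
rewrite (linZ linF); congr (_ *: _).
by elim: (nat_of_ord k) => //= {}k <-; rewrite hF.
Qed.

Lemma poly_act_scale (K : closedFieldType) (U : lmodType K) (T : U -> U) (b : K) p u :
  linear T -> poly_act (fun x => b *: T x) p u = poly_act T (p \Po (b *: 'X)) u.
Proof.
move=> hT; have hit k x : iter k (fun x => b *: T x) x = b ^+ k *: iter k T x.
  elim: k => [|k IH] /=; first by rewrite scale1r.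
  by rewrite IH (linZ hT) scalerA -exprS.
have hs : (size (p \Po (b *: 'X))%R <= size p)%N.
  rewrite comp_polyE; apply: leq_trans (size_sum _ _ _) _; apply/bigmax_leqP => i _.
  apply: leq_trans (size_scale_leq _ _) _; rewrite exprZn.
  by apply: leq_trans (size_scale_leq _ _) _; rewrite size_polyXn.
rewrite (poly_act_widen _ _ hs); apply: eq_bigr => k _; rewrite hit scalerA; congr (_ *: _).
rewrite comp_polyE coef_sum (bigD1 k) //= exprZn !coefZ coefXn eqxx mulr1.
rewrite big1 ?addr0 // => i ik; rewrite exprZn !coefZ coefXn.
by rewrite (inj_eq val_inj) [k == i]eq_sym (negPf ik) !mulr0.
Qed.

(** * Power series in z and Laurent polynomials in t = e^z *)

Section FiniteSums.

Lemma fsum_seq (I : choiceType) (U : zmodType) (F : I -> U) (s : seq I) :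
  uniq s -> (forall d, F d != 0 -> d \in s) ->
  \sum_(d \in [set: I]) F d = \sum_(d <- s) F d.
Proof.
move=> us hs; rewrite [RHS]fsbig_seq //; symmetry;
  apply: (fsbig_widen [set` s] setT) => // d [_ /= hd].
by apply/eqP; apply: contraT => /hs.
Qed.

Lemma fsum_ord (I : choiceType) (U : zmodType) (F : I -> U) n (h : nat -> I) :
  (forall i j, (i < n)%N -> (j < n)%N -> h i = h j -> i = j) ->
  (forall d, F d != 0 -> exists2 i, (i < n)%N & d = h i) ->
  \sum_(d \in [set: I]) F d = \sum_(i < n) F (h i).
Proof.
move=> hinj hs; rewrite (@fsum_seq _ _ _ [seq h i | i <- iota 0 n]).
- by rewrite big_map -{1}[n]subn0 big_mkord.
- rewrite map_inj_in_uniq ?iota_uniq // => i j.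
  by rewrite !mem_iota !add0n /= => hi hj; apply: hinj.
- move=> d /hs [i hi ->]; apply/mapP; exists i => //.
  by rewrite mem_iota add0n.
Qed.

Lemma fsum_eq0 (I : choiceType) (U : zmodType) (F : I -> U) :
  (forall d, F d = 0) -> \sum_(d \in [set: I]) F d = 0.
Proof. by move=> h; apply: fsbig1. Qed.

Lemma fsum_neq0 (I : choiceType) (U : zmodType) (F : I -> U) :
  \sum_(d \in [set: I]) F d != 0 -> exists d, F d != 0.
Proof.
move=> h; apply/not_existsP => hn; case/eqP: h; apply: fsum_eq0 => d.
by apply/eqP/negPn/negP/hn.
Qed.

Lemma fsum_sum (I : choiceType) (U : zmodType) (F : nat -> I -> U) n (s : seq I) :
  uniq s -> (forall k d, (k < n)%N -> F k d != 0 -> d \in s) ->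
  \sum_(d \in [set: I]) \sum_(k < n) F k d = \sum_(k < n) \sum_(d \in [set: I]) F k d.
Proof.
move=> us hs; rewrite (@fsum_seq _ _ _ s) //.
  rewrite exchange_big; apply: eq_bigr => k _.
  by rewrite (@fsum_seq _ _ _ s) // => d; apply: hs.
move=> d; apply: contraR => hd; apply/eqP/big1 => k _.
by apply/eqP; apply: contraT => /(hs k d (ltn_ord k)); rewrite (negPf hd).
Qed.

Lemma sum_triangle (U : zmodType) (F : nat -> nat -> U) m :
  \sum_(i < m.+1) \sum_(j < (m - i).+1) F i j
  = \sum_(l < m.+1) \sum_(i < l.+1) F i (l - i)%N.
Proof.
elim: m => [|m IH]; first by do 4 rewrite ?(big_ord1, subn0) /=.
rewrite [RHS]big_ord_recr /= -IH [LHS]big_ord_recr /= subnn big_ord1.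
rewrite [X in _ = _ + X]big_ord_recr /= subnn addrA; congr (_ + _).
rewrite -big_split /=; apply: eq_bigr => i _.
by rewrite subSn ?leq_ord // big_ord_recr.
Qed.

End FiniteSums.

Section Series.
Context {U : zmodType}.
Implicit Types (f : nat -> U) (P : int -> U).

Definition zmul n f : nat -> U := fun m => if (m < n)%N then 0 else f (m - n)%N.

Definition vanish_below n f : Prop := forall i, (i < n)%N -> f i = 0.

Definition tmul P : int -> U := fun a => P (a - 1).

Definition fin_supp P : Prop := exists L : nat, forall a, P a != 0 -> (`|a| < L)%N.

End Series.

(* A sequence f : nat -> U, together with a shift N, stands for the Laurent
   series \sum_i f_i z^(i - N); P : int -> U stands for \sum_a P_a t^a. *)
Section PowerSeries.
Context {K : numClosedFieldType} {U : lmodType K}.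
Implicit Types (f : nat -> U) (P : int -> U) (psi : nat -> K).

Definition conv (psi : nat -> K) f : nat -> U :=
  fun m => \sum_(i < m.+1) psi i *: f (m - i)%N.

Definition exp_coef (c : K) : nat -> K := fun i => c ^+ i / i`!%:R.

(** Multiplication by e^(c z). Along t = e^z, [expmul 1] is to series in z what [tmul] is to series
    in t. *)
Definition expmul (c : K) : (nat -> U) -> nat -> U := conv (exp_coef c).

Definition exp_eval P : nat -> U := fun m => \sum_(a \in [set: int]) exp_coef a%:~R m *: P a.

Lemma factK i : i`!%:R != 0 :> K.
Proof. by rewrite pnatr_eq0 -lt0n fact_gt0. Qed.

Lemma exp_coef0 c : exp_coef c 0 = 1.
Proof. by rewrite /exp_coef expr0 fact0 divr1. Qed.

Lemma exp_coef_mul c d m : \sum_(i < m.+1) exp_coef c i * exp_coef d (m - i)%N = exp_coef (c + d)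
  m.
Proof.
rewrite /exp_coef addrC exprDn mulr_suml; apply: eq_bigr => -[i /=]; rewrite ltnS => hi _.
have h := bin_fact hi; have {h} <- : ('C(m, i) * (i`! * (m - i)`!))%:R = m`!%:R :> K by rewrite h.
rewrite !natrM -mulr_natr; have := factK i; have := factK (m - i).
have b0 : 'C(m, i)%:R != 0 :> K by rewrite pnatr_eq0 -lt0n bin_gt0.
by move=> h1 h2; field; rewrite h1 h2 b0.
Qed.

Lemma conv_linear psi : linear (conv psi).
Proof.
move=> c f g; apply/funext => m.
rewrite !fctE /conv scaler_sumr -big_split /=; apply: eq_bigr => i _.
by rewrite scalerDr !scalerA mulrC.
Qed.

Lemma expmul_linear c : linear (expmul c).
Proof. exact: conv_linear. Qed.

Lemma expmulD c f g : expmul c (f + g) = expmul c f + expmul c g.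
Proof. exact: linD (expmul_linear c) f g. Qed.

Lemma expmulZ c b f : expmul c (b *: f) = b *: expmul c f.
Proof. exact: linZ (expmul_linear c) b f. Qed.

Lemma expmul_expmul c d f : expmul c (expmul d f) = expmul (c + d) f.
Proof.
apply/funext => m; rewrite /expmul /conv.
under eq_bigr do rewrite scaler_sumr.
rewrite (sum_triangle (fun i j => exp_coef c i *: (exp_coef d j *: f (m - i - j)%N))).
apply: eq_bigr => l _; rewrite -exp_coef_mul scaler_suml; apply: eq_bigr => i _.
by rewrite scalerA; congr (_ *: f _); have := ltn_ord i; have := ltn_ord l; lia.
Qed.

Lemma expmul0 f : expmul 0 f = f.
Proof.
apply/funext => m; rewrite /expmul /conv big_ord_recl /= exp_coef0 scale1r subn0 big1 ?addr0 //
  => i _.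
by rewrite /exp_coef expr0n /= mul0r scale0r.
Qed.

Lemma iter_expmul k f : iter k (expmul 1) f = expmul k%:R f.
Proof.
elim: k => [|k IH] /=; first by rewrite expmul0.
by rewrite IH expmul_expmul -nat1r.
Qed.

Lemma conv_zmul psi n f : conv psi (zmul n f) = zmul n (conv psi f).
Proof.
apply/funext => m; rewrite /conv /zmul; case: ltnP => hm.
  by apply: big1 => i _; rewrite ifT ?scaler0 //; apply: leq_ltn_trans hm; rewrite leq_subr.
rewrite (big_ord_widen m.+1 (fun i => psi i *: f (m - n - i)%N)); last by rewrite ltnS leq_subr.
rewrite [RHS]big_mkcond /=; apply: eq_bigr => i _; have := ltn_ord i => hi.
case: ltnP => h; case: ltnP => h' //; rewrite ?scaler0 //; try lia.
by rewrite subnAC.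
Qed.

Lemma expmul_zmul c n f : expmul c (zmul n f) = zmul n (expmul c f).
Proof. exact: conv_zmul. Qed.

Lemma zmul_linear n : linear (zmul n : (nat -> U) -> nat -> U).
Proof.
move=> c f g; apply/funext => m.
rewrite !fctE /zmul.
by case: ifP => _ //; rewrite scaler0 addr0.
Qed.

Lemma zmul_inj n : injective (zmul n : (nat -> U) -> nat -> U).
Proof.
move=> f g h; apply/funext => m; have := congr1 (fun F => F (m + n)%N) h.
by rewrite /zmul !ifN ?addnK // -leqNgt leq_addl.
Qed.

Lemma poly_act_expmul_zmul p c n f : poly_act (expmul c) p (zmul n f) = zmul n (poly_act (expmul
  c) p f).
Proof.
by rewrite (poly_act_intertwine (T := expmul c) (F := zmul n) p f (zmul_linear n)) // => x;
  rewrite expmul_zmul.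
Qed.

Lemma conv_vanish_below psi n f : vanish_below n f -> vanish_below n (conv psi f).
Proof.
move=> hf i hi; apply: big1 => j _; rewrite hf ?scaler0 //.
by apply: leq_ltn_trans hi; rewrite leq_subr.
Qed.

Lemma conv_lead psi n f : vanish_below n f -> conv psi f n = psi 0 *: f n.
Proof.
move=> hf; rewrite /conv big_ord_recl /= subn0 big1 ?addr0 // => i _.
by rewrite hf ?scaler0 //=; have := ltn_ord i; rewrite /bump; lia.
Qed.

(** The series p(b e^(c z)) has constant term p(b), which therefore multiplies the lowest
    coefficient. *)
Lemma poly_act_expmul_vanish_below c p b n f : vanish_below n f ->
  vanish_below n (poly_act (fun g => b *: expmul c g) p f) /\
  poly_act (fun g => b *: expmul c g) p f n = p.[b] *: f n.
Proof.
move=> hf; have hit k : vanish_below n (iter k (fun g => b *: expmul c g) f) /\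
    iter k (fun g => b *: expmul c g) f n = b ^+ k *: f n.
  elim: k => [|k [IH1 IH2]] /=; first by rewrite scale1r.
  split=> [i hi|].
    by rewrite fctE /expmul (conv_vanish_below _ IH1) // scaler0.
  by rewrite fctE /expmul (conv_lead _ IH1) exp_coef0 scale1r IH2 scalerA exprS.
split=> [i hi|]; rewrite /poly_act fct_sumE.
  by apply: big1 => k _; have [h _] := hit k; rewrite fctE h ?scaler0.
rewrite horner_coef scaler_suml; apply: eq_bigr => k _.
by have [_ h] := hit k; rewrite fctE h scalerA.
Qed.

(** Away from the roots of p the series p(b e^(c z)) is a unit and preserves orders of vanishing.
    This is why points that are not roots carry no residue. *)
Lemma poly_act_expmul_vanish_below_inv c p b n f : p.[b] != 0 ->
  vanish_below n (poly_act (fun g => b *: expmul c g) p f) -> vanish_below n f.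
Proof.
move=> pb h; elim: n h => [|n IH] h i //; rewrite ltnS => hi.
have hl : vanish_below n f by apply: IH => j hj; apply: h; lia.
have [/hl //|ni] := ltnP i n; have -> : i = n by lia.
have [_ hn] := poly_act_expmul_vanish_below c p b hl; rewrite (h n) // in hn.
by move/eqP: (esym hn); rewrite scaler_eq0 (negPf pb) => /eqP.
Qed.

End PowerSeries.

(** * Evaluation of Laurent polynomials at t = e^z *)

Section Evaluation.
Context {K : numClosedFieldType} {U : lmodType K}.
Implicit Types (f : nat -> U) (P Q : int -> U) (p : {poly K}).

Lemma vanish_below_all f : (forall n, vanish_below n f) -> f = 0.
Proof. by move=> h; apply/funext => n; apply: (h n.+1). Qed.

Lemma expmul1_eigen b f : expmul 1 f = b *: f -> f = 0.
Proof.
move=> h; apply: vanish_below_all; elim=> [|n IH] // i; rewrite ltnS => hi.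
have [/IH //|ni] := ltnP i n; have {hi ni} -> : i = n by lia.
(* The series e^z - b has order one if b = 1 and order zero otherwise, so the coefficient to compare
   is n + 1 in the first case and n in the second. *)
have [b1|b1] := eqVneq b 1.
  move/(congr1 (fun g => g n.+1)): h; rewrite b1 fctE scale1r /expmul /conv.
  rewrite !big_ord_recl /= exp_coef0 scale1r subn0 subn1 /= big1 => [|j _].
    by rewrite {1}/exp_coef expr1n divr1 scale1r addr0 -[RHS]addr0 => /addrI.
  by rewrite IH ?scaler0 //= /bump; have := ltn_ord j; lia.
move/(congr1 (fun g => g n)): h; rewrite fctE /expmul (conv_lead _ IH) exp_coef0 => /eqP.
by rewrite -subr_eq0 -scalerBl scaler_eq0 subr_eq0 eq_sym (negPf b1) => /eqP.
Qed.

Lemma poly_act_expmul_inj p f : p != 0 -> poly_act (expmul 1) p f = 0 -> f = 0.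
Proof.
move=> p0; apply: (@poly_act_inj _ _ (expmul 1) (fun=> True)) => //; first exact: expmul_linear.
by move=> b g _; apply: expmul1_eigen.
Qed.

Lemma fin_supp0 : fin_supp (0 : int -> U).
Proof. by exists 0%N => a; rewrite eqxx. Qed.

Lemma fin_suppD P Q : fin_supp P -> fin_supp Q -> fin_supp (P + Q).
Proof.
move=> [L hL] [M hM]; exists (maxn L M) => a; rewrite fctE => h.
rewrite leq_max; have [P0|/hL -> //] := eqVneq (P a) 0.
by rewrite hM ?orbT //; rewrite P0 add0r in h.
Qed.

Lemma fin_suppZ c P : fin_supp P -> fin_supp (c *: P).
Proof.
move=> [L hL]; exists L => a; rewrite fctE => h; apply: hL.
by apply: contraNneq h => ->; rewrite scaler0.
Qed.

Lemma fin_supp_tmul P : fin_supp P -> fin_supp (tmul P).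
Proof. by move=> [L hL]; exists L.+1 => a /hL; lia. Qed.

Lemma fin_supp_poly_act p P : fin_supp P -> fin_supp (poly_act (@tmul U) p P).
Proof.
elim/poly_ind: p P => [|p c IH] P hP; first by rewrite (poly_actC _ 0) scale0r; exact: fin_supp0.
by rewrite poly_act_addp poly_actXr poly_actC; apply: fin_suppD;
  [exact/IH/fin_supp_tmul | exact: fin_suppZ].
Qed.

Lemma exp_evalE (L : nat) P (m : nat) : (forall a, P a != 0 -> (`|a| < L)%N) ->
  exp_eval P m = \sum_(i < L.*2) exp_coef ((i%:Z - L%:Z)%:~R : K) m *: P (i%:Z - L%:Z).
Proof.
move=> hL; rewrite /exp_eval (@fsum_ord _ _ _ L.*2 (fun i => i%:Z - L%:Z)) //.
  by move=> i j _ _; lia.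
move=> a h; have {}h : P a != 0 by apply: contraNneq h => ->; rewrite scaler0.
by exists (absz (a + L%:Z)); have := hL _ h; lia.
Qed.

Lemma fin_supp_common P Q : fin_supp P -> fin_supp Q ->
  exists L : nat, (forall a, P a != 0 -> (`|a| < L)%N) /\ (forall a, Q a != 0 -> (`|a| < L)%N).
Proof.
move=> [L hL] [M hM]; exists (maxn L M); split=> a h; rewrite leq_max.
  by rewrite hL.
by rewrite hM ?orbT.
Qed.

(** Finite support matters: a sum with infinite support defaults to 0, and that default is not
    additive. *)
Lemma exp_evalD P Q : fin_supp P -> fin_supp Q -> exp_eval (P + Q) = exp_eval P + exp_eval Q.
Proof.
move=> hP hQ; have [L [h1 h2]] := fin_supp_common hP hQ; apply/funext => m.
rewrite -[RHS]/(exp_eval P m + exp_eval Q m) (exp_evalE m h1) (exp_evalE m h2) (@exp_evalE L);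
  last first.
  move=> a; rewrite fctE => h; have [P0|/h1 //] := eqVneq (P a) 0.
  by apply: h2; rewrite P0 add0r in h.
by rewrite -big_split /=; apply: eq_bigr => i _; rewrite fctE scalerDr.
Qed.

Lemma exp_evalZ c P : fin_supp P -> exp_eval (c *: P) = c *: exp_eval P.
Proof.
move=> [L hL]; apply/funext => m.
rewrite -[RHS]/(c *: exp_eval P m) (exp_evalE m hL) (@exp_evalE L); last first.
  by move=> a; rewrite fctE => h; apply: hL; apply: contraNneq h => ->; rewrite scaler0.
by rewrite scaler_sumr; apply: eq_bigr => i _; rewrite fctE !scalerA mulrC.
Qed.

Lemma exp_eval0 : exp_eval (0 : int -> U) = 0.
Proof. by apply/funext => m; apply: fsum_eq0 => d; rewrite scaler0. Qed.

Lemma exp_evalB P Q : fin_supp P -> fin_supp Q -> exp_eval (P - Q) = exp_eval P - exp_eval Q.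
Proof.
by move=> hP hQ; rewrite -[- Q]scaleN1r (exp_evalD hP (fin_suppZ _ hQ)) exp_evalZ // scaleN1r.
Qed.

Lemma exp_eval_tmul P : fin_supp P -> exp_eval (tmul P) = expmul 1 (exp_eval P).
Proof.
move=> [L hL]; apply/funext => m.
have -> : exp_eval (tmul P) m = \sum_(a \in [set: int]) exp_coef ((a + 1)%:~R : K) m *: P a.
  rewrite /exp_eval (reindex_fsbigT (fun a : int => a + 1)) /=.
    by apply: eq_fsbigr => a _; rewrite /tmul addrK.
  by exists (fun a : int => a - 1) => a; rewrite ?addrK ?subrK.
rewrite (@fsum_ord _ _ _ L.*2 (fun i => i%:Z - L%:Z)); first last.
- move=> a h; have {}h : P a != 0 by apply: contraNneq h => ->; rewrite scaler0.
  by exists (absz (a + L%:Z)); have := hL _ h; lia.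
- by move=> i j _ _; lia.
rewrite /expmul /conv.
under [RHS]eq_bigr do rewrite (exp_evalE _ hL) scaler_sumr.
rewrite exchange_big; apply: eq_bigr => i _ /=.
rewrite rmorphD addrC -exp_coef_mul scaler_suml; apply: eq_bigr => j _.
by rewrite scalerA.
Qed.

Lemma exp_eval_poly_act p P : fin_supp P -> exp_eval (poly_act (@tmul U) p P) = poly_act (expmul
  1) p (exp_eval P).
Proof.
elim/poly_ind: p P => [|p c IH] P hP; first by rewrite !(poly_actC _ 0) !scale0r exp_eval0.
rewrite !poly_act_addp !poly_actXr !poly_actC exp_evalD;
  first by rewrite IH ?exp_eval_tmul ?exp_evalZ //; exact: fin_supp_tmul.
  exact/fin_supp_poly_act/fin_supp_tmul.
exact: fin_suppZ.
Qed.

(** The exponentials e^(a z) are linearly independent: the coefficients of P(e^z) are the power sums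
    of the exponents up to factorials, so the sum of q(a) P_a vanishes for every polynomial q, in
    particular for one that vanishes at all exponents of the window but one. *)
Lemma exp_eval_inj P : fin_supp P -> exp_eval P = 0 -> P = 0.
Proof.
move=> [L hL] h0.
have hpow k : \sum_(i < L.*2) ((i%:Z - L%:Z)%:~R : K) ^+ k *: P (i%:Z - L%:Z) = 0.
  apply: (scalerI (invr_neq0 (factK k))); rewrite scaler0.
  rewrite -[RHS]/((0 : nat -> U) k) -h0 (exp_evalE k hL) scaler_sumr; apply: eq_bigr => i _.
  by rewrite scalerA mulrC.
have hpoly q : \sum_(i < L.*2) q.[(i%:Z - L%:Z)%:~R] *: P (i%:Z - L%:Z) = 0.
  under eq_bigr do rewrite horner_coef scaler_suml.
  rewrite exchange_big big1 //= => k _.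
  under eq_bigr do rewrite -scalerA.
  by rewrite -scaler_sumr hpow scaler0.
apply/funext => a; rewrite -[RHS]/(0 : U); apply/eqP; apply: contraT => ha.
have hk : (absz (a + L%:Z)%R < L.*2)%N by have := hL _ ha; lia.
have := hpoly (\prod_(j < L.*2 | j != Ordinal hk) ('X - (j%:Z - L%:Z)%:~R%:P)).
rewrite (bigD1 (Ordinal hk)) //= [X in _ + X]big1 ?addr0 => [|i ik]; last first.
  by rewrite horner_prod (bigD1 i) //= hornerXsubC subrr mul0r scale0r.
have -> : (absz (a + L%:Z))%:Z - L%:Z = a by have := hL _ ha; lia.
move=> /eqP; rewrite scaler_eq0 (negPf ha) orbF horner_prod prodf_seq_eq0.
case/hasP => j _ /andP [jk]; rewrite hornerXsubC -intrB intr_eq0 => /eqP hj.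
case/eqP: jk; apply: val_inj => /=; have := hL _ ha; have := ltn_ord j; lia.
Qed.

End Evaluation.

(** * The residue formula *)

Section Residues.
Context {K : numClosedFieldType} {U : lmodType K}.
Implicit Types (f : nat -> U) (P A S : int -> U) (p q : {poly K}).

(** The action of t on expansions along t = b e^z. *)
Definition bexpmul (b : K) (g : nat -> U) : nat -> U := b *: expmul 1 g.

(* d/dz of z^(-N) f(z), as a series with shift N + 1. *)
Definition zderiv N f : nat -> U := fun i => ((i%:Z - N%:Z)%:~R : K) *: f i.

Definition tderiv P : int -> U := fun a => (a%:~R : K) *: P a.

(** P(b t), whose value at t = e^z is the value of P at t = b e^z. *)
Definition dilate (b : K) P : int -> U := fun a => b ^ a *: P a.

(* Res_z of (b e^z)^(-a) z^(-N-1) f(z). *)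
Definition exp_residue (b : K) (N : nat) f (a : int) : U := b ^ (- a) *: expmul (- a%:~R) f N.

Lemma bexpmul_linear b : linear (bexpmul b).
Proof. by move=> c f g; rewrite /bexpmul expmul_linear scalerDr !scalerA mulrC. Qed.

Lemma tmul_lin : linear (tmul : (int -> U) -> int -> U).
Proof. by []. Qed.

(** Stated abstractly to serve two derivations: t d/dt on series in t, with [s] the identity, and
    d/dz on series in z. In the second case differentiation raises the shift by one, and [s] is
    [zmul 1], which restores the common shift in the undifferentiated term. *)
Lemma poly_act_leibniz (M : lmodType K) (T th s : M -> M) p u :
  linear T -> linear th -> linear s ->
  (forall x, th (T x) = T (th x) + s (T x)) -> (forall x, s (T x) = T (s x)) ->
  th (poly_act T p u) = poly_act T p (th u) + s (T (poly_act T p^`() u)).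
Proof.
move=> hT hth hs h1 h2; elim/poly_ind: p u => [|q c IH] u.
  by rewrite deriv0 !(poly_actC _ 0) !scale0r (lin0 hth) (lin0 hT) (lin0 hs) addr0.
rewrite derivMXaddC !poly_act_addp !poly_actXr !poly_actC (linD hth) (linZ hth) IH h1 (poly_actD
  hT).
have h3 : s (T (poly_act T q u)) = poly_act T q (s (T u)).
  rewrite -(poly_actX T (poly_act T q u)) -poly_actM // -commr_polyX poly_actXr.
  exact: (poly_act_intertwine (T := T) (F := s)).
rewrite (linD hT) (linD hs) h3 -!addrA; congr (_ + _).
by rewrite [RHS]addrC -addrA.
Qed.

Lemma zderiv_linear N : linear (zderiv N).
Proof.
move=> c f g; apply/funext => i.
by rewrite -[RHS]/(c *: zderiv N f i + zderiv N g i) /zderiv scalerDr !scalerA mulrC.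
Qed.

Lemma tderiv_linear : linear tderiv.
Proof.
move=> c f g; apply/funext => i.
by rewrite -[RHS]/(c *: tderiv f i + tderiv g i) /tderiv scalerDr !scalerA mulrC.
Qed.

Lemma dilate_linear b : linear (dilate b).
Proof.
move=> c f g; apply/funext => i.
by rewrite -[RHS]/(c *: dilate b f i + dilate b g i) /dilate scalerDr !scalerA mulrC.
Qed.

Lemma tderiv_tmul A : tderiv (tmul A) = tmul (tderiv A) + tmul A.
Proof.
apply/funext => a; rewrite -[RHS]/(tderiv A (a - 1) + A (a - 1)) /tderiv /tmul.
by rewrite intrB scalerBl scale1r subrK.
Qed.

Lemma fin_supp_tderiv P : fin_supp P -> fin_supp (tderiv P).
Proof.
move=> [L hL]; exists L => a h; apply: hL; apply: contraNneq h => h.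
by rewrite /tderiv h scaler0.
Qed.

Lemma fin_supp_dilate b P : fin_supp P -> fin_supp (dilate b P).
Proof.
move=> [L hL]; exists L => a h; apply: hL; apply: contraNneq h => h.
by rewrite /dilate h scaler0.
Qed.

Lemma exp_coefS (c : K) m : m.+1%:R * exp_coef c m.+1 = c * exp_coef c m.
Proof.
rewrite /exp_coef factS natrM exprS; have := @factK K m.
by move=> h; field; rewrite h /= addrC natr1 pnatr_eq0.
Qed.

Lemma zderiv_expmul N c f : zderiv N (expmul c f) = expmul c (zderiv N f) + c *: zmul 1 (expmul c
  f).
Proof.
apply/funext => m.
rewrite -[RHS]/(expmul c (zderiv N f) m + c *: zmul 1 (expmul c f) m) /zderiv /expmul /conv.
rewrite scaler_sumr; apply/eqP; rewrite -subr_eq0 opprD addrA -sumrB subr_eq0; apply/eqP.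
under eq_bigr => i _ do rewrite !scalerA -scalerBl.
rewrite /zmul; case: m => [|m] /=.
  by rewrite scaler0 big_ord1 subn0 mulrC subrr scale0r.
rewrite big_ord_recl /= subn0 mulrC subrr scale0r add0r scaler_sumr.
rewrite subn1 /=; apply: eq_bigr => i _; rewrite scalerA /bump add1n subSS; congr (_ *: _).
rewrite mulrC -mulrBr mulrC -exp_coefS; congr (_ * _).
by rewrite -intrB -[RHS]/(i.+1%:Z%:~R); congr (_%:~R); have := ltn_ord i; lia.
Qed.

Lemma zderiv_bexpmul N b f : zderiv N (bexpmul b f) = bexpmul b (zderiv N f) + zmul 1 (bexpmul b
  f).
Proof.
rewrite /bexpmul (linZ (zderiv_linear N)) zderiv_expmul scale1r scalerDr.
by rewrite (linZ (zmul_linear 1)).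
Qed.

Lemma zmul1_bexpmul b f : zmul 1 (bexpmul b f) = bexpmul b (zmul 1 f).
Proof. by rewrite /bexpmul (linZ (zmul_linear 1)) expmul_zmul. Qed.

Lemma zderiv_exp_eval N P : fin_supp P ->
  zderiv N.+1 (zmul N.+1 (exp_eval P)) = zmul N.+2 (exp_eval (tderiv P)).
Proof.
move=> [L hL]; have hL' a : tderiv P a != 0 -> (`|a| < L)%N.
  by move=> h; apply: hL; apply: contraNneq h => h; rewrite /tderiv h scaler0.
apply/funext => i; rewrite /zderiv /zmul.
have [i1|i1] := ltnP i N.+1; first by rewrite scaler0 ifT // ltnS ltnW.
have [i2|i2] := ltnP i N.+2.
  have -> : i = N.+1 by lia.
  by rewrite subrr scale0r.
have [j ->] : exists j, i = (j + N.+2)%N by exists (i - N.+2)%N; rewrite subnK.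
rewrite addnK (exp_evalE _ hL') (_ : (j + N.+2 - N.+1 = j.+1)%N); last by lia.
rewrite (exp_evalE _ hL) scaler_sumr; apply: eq_bigr => a _.
rewrite /tderiv !scalerA; congr (_ *: _); rewrite [RHS]mulrC -exp_coefS.
by congr (_ * _); rewrite -[RHS]/(j.+1%:Z%:~R); congr (_%:~R); lia.
Qed.

Lemma exp_residue_vanish_below b N f a : vanish_below N.+1 f -> exp_residue b N f a = 0.
Proof. by move=> h; rewrite /exp_residue /expmul (conv_vanish_below _ h) // scaler0. Qed.

Lemma exp_residueD b N f g a : exp_residue b N (f + g) a = exp_residue b N f a + exp_residue b N
  g a.
Proof. by rewrite /exp_residue expmulD scalerDr. Qed.

Lemma exp_residueZ b N c f a : exp_residue b N (c *: f) a = c *: exp_residue b N f a.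
Proof. by rewrite /exp_residue expmulZ -[(c *: _) N]/(c *: expmul _ f N) !scalerA mulrC. Qed.

Lemma exp_residueB b N f g a : exp_residue b N (f - g) a = exp_residue b N f a - exp_residue b N
  g a.
Proof. by rewrite -[- g]scaleN1r exp_residueD exp_residueZ scaleN1r. Qed.

Lemma exp_residue_bexpmul b N f a : b != 0 -> exp_residue b N (bexpmul b f) a = exp_residue b N f
  (a - 1).
Proof.
move=> b0; rewrite /bexpmul exp_residueZ /exp_residue scalerA expmul_expmul opprB intrB opprB
  addrC.
by rewrite addrC expfzDr // expr1z [- _ + _]addrC.
Qed.

Lemma exp_residue_zmul1 b N f a : exp_residue b N.+1 (zmul 1 f) a = exp_residue b N f a.
Proof. by rewrite /exp_residue expmul_zmul /zmul subn1. Qed.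

(** Integration by parts: a derivative has no residue, because [zderiv] multiplies that coefficient
    by 0, and the product rule is applied to e^(-a z) f. *)
Lemma exp_residue_zderiv b N f a : exp_residue b N.+1 (zderiv N.+1 f) a = a%:~R *: exp_residue b
  N f a.
Proof.
have := congr1 (fun g => g N.+1) (zderiv_expmul N.+1 (- a%:~R) f).
rewrite -[RHS]/(expmul (- a%:~R) (zderiv N.+1 f) N.+1 + - a%:~R *: expmul (- a%:~R) f (N.+1 -
  1)%N).
rewrite {1}/zderiv subrr scale0r subn1 scaleNr => /esym/eqP; rewrite subr_eq0 => /eqP h.
by rewrite /exp_residue h !scalerA mulrC.
Qed.

(** Such D form the kernel of t - b, that is, the multiples of delta(t / b); they are determined by
    one coefficient. *)
Lemma geometric (b : K) (D : int -> U) : b != 0 ->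
  (forall a, D (a - 1) = b *: D a) -> forall a, b ^ a *: D a = D 0.
Proof.
move=> b0 h; elim/int_ind => [|n IH|n IH]; first by rewrite expr0z scale1r.
  by rewrite -IH -[n.+1]addn1 PoszD expfzDr // -scalerA -h addrK.
by rewrite -IH -[n.+1]addn1 PoszD opprD h scalerA -{2}(expr1z b) -expfzDr // subrK.
Qed.

Lemma poly_act_tmul_root z A : poly_act (@tmul U) ('X - z%:P) A = (fun a => A (a - 1) - z *: A a).
Proof. by rewrite poly_actXsub. Qed.

(* The sum of the b^a P a telescopes, because D = A - S is
   geometric, A vanishes far right and S far left. *)
Lemma telescope_simple (b c : K) A S P f N : b != 0 -> c != 0 -> fin_supp P ->
  poly_act (@tmul U) (c *: ('X - b%:P)) A = P -> poly_act (@tmul U) (c *: ('X - b%:P)) S = P ->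
  (exists L : int, forall a, L <= a -> A a = 0) ->
  (exists L : int, forall a, a < L -> S a = 0) ->
  poly_act (bexpmul b) (c *: ('X - b%:P)) f = zmul N.+1 (exp_eval (dilate b P)) ->
  A 0 - S 0 = f N.
Proof.
move=> b0 c0 [L1 hP] hA hS [L2 hL2] [L3 hL3] hf.
have [L [hL hAL hSL]] : exists L : nat, [/\ forall a, P a != 0 -> (`|a| < L)%N,
    A (L%:Z - 1) = 0 & S (- L%:Z - 1) = 0].
  exists (maxn L1 (maxn (`|L2|).+1 (`|L3|).+1)); split.
  - by move=> a /hP; lia.
  - by apply: hL2; lia.
  - by apply: hL3; lia.
have eA a : P a = c *: (A (a - 1) - b *: A a).
  by rewrite -hA poly_act_scalep poly_act_tmul_root.
have eS a : P a = c *: (S (a - 1) - b *: S a).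
  by rewrite -hS poly_act_scalep poly_act_tmul_root.
have eD a : A (a - 1) - S (a - 1) = b *: (A a - S a).
  apply: (scalerI c0); have := eA a; rewrite eS scalerBr.
  rewrite !scalerBr => h; apply/eqP; rewrite -subr_eq0 -(subrr (c *: S (a - 1) - c *: (b *: S
    a))).
  by rewrite {1}h; apply/eqP; rewrite opprB !addrA addrAC opprD !addrA opprK;
     rewrite -!addrA; congr (_ + _); rewrite addrCA; congr (_ + _); rewrite addrC.
have D0 : b ^ (L%:Z - 1) *: S (L%:Z - 1) = - (A 0 - S 0).
  rewrite -(geometric (D := fun a => A a - S a) b0 eD (L%:Z - 1)) hAL sub0r.
  by rewrite scalerN opprK.
(* The left side is P(b). On the side of z, c b (e^z - 1) f = z^(N+1) P(b e^z), whose coefficient at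
   N + 1 gives P(b) = c b f_N. *)
have hsum : exp_eval (dilate b P) 0 = (c * b) *: (A 0 - S 0).
  have hL' a : dilate b P a != 0 -> (`|a| < L)%N.
    by move=> h; apply: hL; apply: contraNneq h => h; rewrite /dilate h scaler0.
  rewrite (exp_evalE 0 hL').
  pose h (i : nat) : U := c *: (b ^ (i%:Z - L%:Z) *: S (i%:Z - L%:Z - 1)).
  have -> : \sum_(i < L.*2) exp_coef ((i%:Z - L%:Z)%:~R : K) 0 *: dilate b P (i%:Z - L%:Z)
     = - \sum_(0 <= i < L.*2) (h i.+1 - h i).
    rewrite big_mkord -sumrN; apply: eq_bigr => i _.
    rewrite exp_coef0 scale1r /dilate eS opprB /h scalerA [_ * c]mulrC -scalerA -!scalerBr;
      congr (_ *: _).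
    rewrite scalerBr; congr (_ - _).
    rewrite (_ : i.+1%:Z - L%:Z = i%:Z - L%:Z + 1); last by lia.
    by rewrite addrK [in RHS]expfzDr // expr1z scalerA.
  rewrite telescope_sumr // /h opprB.
  rewrite (_ : 0%:Z - L%:Z - 1 = - L%:Z - 1) ?sub0r // hSL !scaler0 sub0r.
  rewrite (_ : (L.*2)%:Z - L%:Z - 1 = L%:Z - 1); last by lia.
  rewrite (_ : b ^ ((L.*2)%:Z - L%:Z) = b * b ^ (L%:Z - 1)); last first.
    by rewrite -{2}(expr1z b) -expfzDr //; congr (b ^ _); lia.
  by rewrite -!scalerA D0 !scalerN opprK.
move: hf; rewrite poly_act_scalep poly_actXsub => hf.
have hf' i : c *: (b *: (expmul 1 f i - f i)) = zmul N.+1 (exp_eval (dilate b P)) i.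
  by rewrite -hf scalerBr.
(* The factor e^z - 1 has order one and the product has order at least N + 1, so f has order at
   least N. *)
have hl : vanish_below N f.
  have : forall k, (k <= N)%N -> vanish_below k f; last by apply.
  elim=> [|k IH] // kN i; rewrite ltnS => hi; have lk := IH (ltnW kN).
  have [/lk //|ki] := ltnP i k; have {hi ki} -> : i = k by lia.
  have := hf' k.+1; rewrite /zmul ifT ?ltnS // /expmul /conv => /eqP.
  rewrite !scaler_eq0 (negPf c0) (negPf b0) /= !big_ord_recl /= exp_coef0 scale1r subn0 subn1 /=.
  rewrite big1 => [|j _]; last by rewrite lk ?scaler0 //= /bump; have := ltn_ord j; lia.
  by rewrite {1}/exp_coef expr1n divr1 scale1r addr0 addrC addKr => /eqP.
have := hf' N.+1; rewrite /zmul ltnn subnn hsum /expmul /conv !big_ord_recl /= exp_coef0 scale1r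
  subn0 subn1 /=.
rewrite big1 => [|j _]; last by rewrite hl ?scaler0 //= /bump; have := ltn_ord j; lia.
rewrite {1}/exp_coef expr1n divr1 scale1r addr0 addrC addKr scalerA => h.
by apply: (scalerI (mulf_neq0 c0 b0)); rewrite -h.
Qed.

End Residues.

Lemma sub_rearrange (U : zmodType) (a1 za s1 zs r1 r2 : U) :
  a1 - za - (s1 - zs) = r1 - r2 -> a1 - s1 - r1 = za - zs - r2.
Proof.
move=> h; have -> : a1 - s1 = (r1 - r2) + (za - zs).
  rewrite -h opprB (AC (2*2*2) ((1*4)*(3*6)*(2*5)))%AC /=.
  by rewrite subrr addr0 addNr addr0.
by rewrite (AC (2*2*1) ((1*5)*(3*4*2)))%AC /= subrr add0r.
Qed.

(** The induction is on the degree of p. Each root z makes the defect [E] satisfy E (a - 1) = z E a,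
    so two distinct roots force E = 0, and only powers of a single t - b remain. Points [al j] that
    are not roots are allowed and contribute nothing. *)
Lemma residue_formula (K : numClosedFieldType) (U : lmodType K) (n : nat)
    (al : 'I_n -> K) (p : {poly K}) (N : 'I_n -> nat) (A S P : int -> U)
    (f : 'I_n -> nat -> U) :
  injective al -> (forall j, al j != 0) ->
  p != 0 -> (forall z, root p z -> exists j, al j = z) -> fin_supp P ->
  poly_act (@tmul U) p A = P -> poly_act (@tmul U) p S = P ->
  (exists L : int, forall a, L <= a -> A a = 0) ->
  (exists L : int, forall a, a < L -> S a = 0) ->
  (forall j, poly_act (bexpmul (al j)) p (f j) = zmul (N j).+1 (exp_eval (dilate (al j) P))) ->
  forall a, A a - S a = \sum_j exp_residue (al j) (N j) (f j) a.
Proof.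
move=> al_inj al0; have [s] := ubnP (size p).
elim: s => // s IH in p N A S P f *; rewrite ltnS => hs p0 hroot hP hA hS hAL hSL hf.
pose E a := A a - S a - \sum_j exp_residue (al j) (N j) (f j) a.
suff hE a : E a = 0 by move=> a; apply/eqP; rewrite -subr_eq0; apply/eqP; apply: hE.
(* Multiplying A and S by t - z, and each [f j] by al_j e^z - z, gives data for p / (t - z) with the
   same numerator P. The residues obey the same shift rule, so the induction hypothesis becomes this
   recursion. *)
have step z a0 : root p z -> E (a0 - 1) = z *: E a0.
  move=> /[dup] rz /factor_theorem [q pq].
  have q0 : q != 0 by apply: contraNneq p0 => q0; rewrite pq q0 mul0r.
  have hq : (size q < s)%N.
    by move: hs; rewrite pq size_Mmonic ?monicXsubC // size_XsubC addn2.
  have hTq (V : lmodType K) (T : V -> V) : linear T -> forall u, poly_act T q (T u - z *: u) =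
    poly_act T p u.
    by move=> hT u; rewrite pq poly_actM // poly_actXsub.
  have := IH q N (tmul A - z *: A) (tmul S - z *: S) P
            (fun j => bexpmul (al j) (f j) - z *: f j) hq q0 _ hP _ _ _ _ _ a0.
  rewrite !hTq; try exact: tmul_lin.
  move=> /(_ _ hA hS) IHq; rewrite /E.
  rewrite -[(tmul A - z *: A) a0]/(A (a0 - 1) - z *: A a0) in IHq.
  rewrite -[(tmul S - z *: S) a0]/(S (a0 - 1) - z *: S a0) in IHq.
  have {}IHq : A (a0 - 1) - z *: A a0 - (S (a0 - 1) - z *: S a0)
    = \sum_j (exp_residue (al j) (N j) (f j) (a0 - 1) - z *: exp_residue (al j) (N j) (f j) a0).
    rewrite IHq.
    - by apply: eq_bigr => j _; rewrite exp_residueB exp_residue_bexpmul // exp_residueZ.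
    - by move=> x rx; apply: hroot; rewrite pq rootM rx.
    - have [L hL] := hAL; exists (L + 1) => y hy.
      rewrite -[LHS]/(A (y - 1) - z *: A y) !hL ?scaler0 ?subr0 //; lia.
    - have [L hL] := hSL; exists L => y hy.
      rewrite -[LHS]/(S (y - 1) - z *: S y) !hL ?scaler0 ?subr0 //; lia.
    - by move=> j; rewrite hTq //; apply: bexpmul_linear.
  move: IHq; rewrite sumrB -scaler_sumr !scalerBr.
  exact: sub_rearrange.
have Esum z1 z2 a0 : root p z1 -> root p z2 -> z1 != z2 -> E a0 = 0.
  move=> r1 r2 z12; have := step z1 a0 r1; rewrite (step z2 a0 r2) => /eqP.
  by rewrite -subr_eq0 -scalerBl scaler_eq0 subr_eq0 eq_sym (negPf z12) => /eqP.
have [s1|s1] := eqVneq (size p) 1%N.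
  have /size_poly1P [c c0 pc] : size p == 1%N by apply/eqP.
  have AS : A = S.
    by apply: (scalerI c0); rewrite -!(poly_actC (@tmul U)) -pc hA hS.
  rewrite /E AS subrr sub0r big1 ?oppr0 // => j _; apply: exp_residue_vanish_below.
  apply: (@poly_act_expmul_vanish_below_inv _ _ 1 p (al j)); first by rewrite pc hornerC.
  by move: (hf j) => hj i hi; rewrite [LHS](congr1 (fun g => g i) hj) /zmul hi.
have /closed_rootP [b rb] := s1.
have [j0 bj0] := hroot b rb; have b0 : b != 0 by rewrite -bj0.
have [[z rz zb]|hall] := pselect (exists2 z, root p z & z != b).
  exact: (Esum z b).
have [r pr] := closed_field_poly_normal p; set c := lead_coef p in pr.
have c0 : c != 0 by rewrite lead_coef_eq0.
have {}pr : p = c *: ('X - b%:P) ^+ size r.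
  rewrite pr; congr (_ *: _); rewrite (eq_big_seq (fun=> 'X - b%:P)) => [|z zr].
    by rewrite big_const_seq count_predT iter_mulr_1.
  congr ('X - _%:P); apply/eqP; apply: contraT => zb; case: hall; exists z => //.
  by rewrite pr rootZ // root_prod_XsubC.
have hsz : size p = (size r).+1.
  by rewrite pr size_scale // size_exp_XsubC.
case er: (size r) => [|[|m]] in pr hsz.
- by rewrite hsz in s1.
- rewrite expr1 in pr.
  (* By [geometric] the exponent 0 suffices. There the root contributes the coefficient computed by
     [telescope_simple], and p does not vanish at the other points. *)
  have E0 : E 0 = 0.
    rewrite /E (bigD1 j0) //= big1 ?addr0 => [|j jj].
      rewrite /exp_residue oppr0 expr0z scale1r mulr0z oppr0 expmul0.
      rewrite (@telescope_simple _ _ b c A S P (f j0) (N j0)) ?subrr -?pr //.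
      by rewrite -bj0 hf.
    apply: exp_residue_vanish_below; apply: (@poly_act_expmul_vanish_below_inv _ _ 1 p (al j)).
      rewrite pr hornerZ hornerXsubC mulf_neq0 // subr_eq0 -bj0.
      by apply: contra jj => /eqP /al_inj ->.
    by move: (hf j) => hj i hi; rewrite [LHS](congr1 (fun g => g i) hj) /zmul hi.
  have := geometric b0 (fun x => step b x rb) a; rewrite E0 => /eqP.
  by rewrite scaler_eq0 expfz_eq0 (negPf b0) andbF => /eqP.
(* For a root of multiplicity m + 2 the induction hypothesis applies to
   (t - b) t G' + (m + 2) t G with G = P / p, which is t P' / p1. *)
pose p1 : {poly K} := c *: ('X - b%:P) ^+ m.+1.
have p10 : p1 != 0 by rewrite scaler_eq0 negb_or c0 expf_neq0 ?polyXsubC_eq0.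
have hs1 : (size p1 < s)%N.
  by move: hs; rewrite hsz /p1 size_scale // size_exp_XsubC.
have pp1 : p = p1 * ('X - b%:P) by rewrite pr /p1 -scalerAl -exprSr.
have dp : p^`() = m.+2%:R *: p1.
  rewrite pr /p1 derivZ deriv_exp derivXsubC mul1r /= -scalerMnr scaler_nat.
  by [].
(* One formula for both kinds of series, with [th] and [sx] the derivation and the shift correction
   of [poly_act_leibniz]. *)
pose H (M : lmodType K) (T th sx : M -> M) (x : M) :=
  (T (th x) - b *: th x) + m.+2%:R *: sx (T x).
have HP (M : lmodType K) (T th sx : M -> M) x : linear T -> linear th -> linear sx ->
    (forall x, th (T x) = T (th x) + sx (T x)) -> (forall x, sx (T x) = T (sx x)) ->
    poly_act T p1 (H M T th sx x) = th (poly_act T p x).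
  move=> hT hth hsx h1 h2; rewrite (poly_act_leibniz p x hT hth hsx h1 h2).
  rewrite /H (poly_actD hT) pp1 (poly_actM hT) poly_actXsub; congr (_ + _).
  rewrite -pp1 dp (poly_act_scalep T m.+2%:R p1) (linZ hT) (linZ hsx) (poly_actZ hT);
    congr (_ *: _).
  rewrite -(poly_actX T (poly_act T p1 x)) -poly_actM // -commr_polyX poly_actXr.
  by rewrite (poly_act_intertwine (T := T) (F := sx)).
have := IH p1 (fun j => (N j).+1) (H _ tmul tderiv id A) (H _ tmul tderiv id S) (tderiv P)
   (fun j => H _ (bexpmul (al j)) (zderiv (N j).+1) (zmul 1) (f j)) hs1 p10.
have HZ (X : int -> U) : poly_act (@tmul U) p1 (H _ tmul tderiv id X) = tderiv (poly_act (@tmul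
  U) p X).
  apply: HP => //; [exact: tderiv_linear | exact: tderiv_tmul].
rewrite !HZ hA hS => IHq.
have HE (X : int -> U) x : H _ tmul tderiv id X x =
    ((x - 1)%:~R *: X (x - 1) - (b * x%:~R) *: X x) + m.+2%:R *: X (x - 1).
  by rewrite -scalerA.
have {}IHq := IHq _ (fin_supp_tderiv hP) erefl erefl _ _ _ a.
have hr j : exp_residue (al j) (N j).+1 (H _ (bexpmul (al j)) (zderiv (N j).+1) (zmul 1) (f j)) a
  =
  ((a - 1)%:~R *: exp_residue (al j) (N j) (f j) (a - 1) - (b * a%:~R) *: exp_residue (al j) (N
    j) (f j) a)
    + m.+2%:R *: exp_residue (al j) (N j) (f j) (a - 1).
  rewrite /H exp_residueD exp_residueB exp_residue_bexpmul // !exp_residueZ !exp_residue_zderiv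
    exp_residue_zmul1 exp_residue_bexpmul // scalerA.
  by [].
have hlin : ((a - 1)%:~R *: E (a - 1) - (b * a%:~R) *: E a) + m.+2%:R *: E (a - 1) = 0.
  have roots1 z : root p1 z -> exists j, al j = z.
    by move=> rz; apply: hroot; rewrite pp1 rootM rz.
  have hH j : poly_act (bexpmul (al j)) p1 (H _ (bexpmul (al j)) (zderiv (N j).+1) (zmul 1) (f j))
      = zmul (N j).+2 (exp_eval (dilate (al j) (tderiv P))).
    rewrite (HP _ (bexpmul (al j)) _ _ (f j) (bexpmul_linear (al j)) (zderiv_linear (N j).+1)
      (zmul_linear 1)
      (zderiv_bexpmul (N j).+1 (al j)) (zmul1_bexpmul (al j))) hf (zderiv_exp_eval _
        (fin_supp_dilate _ hP)).
    congr (zmul _ (exp_eval _)); apply/funext => x.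
    by rewrite /dilate /tderiv !scalerA mulrC.
  have hHA : exists L : int, forall x, L <= x -> H _ tmul tderiv id A x = 0.
    have [L hL] := hAL; exists (L + 1) => x hx; rewrite HE !hL ?scaler0 ?subr0 ?addr0 //; lia.
  have hHS : exists L : int, forall x, x < L -> H _ tmul tderiv id S x = 0.
    have [L hL] := hSL; exists L => x hx; rewrite HE !hL ?scaler0 ?subr0 ?addr0 //; lia.
  have := IHq roots1 hHA hHS hH; rewrite !HE (eq_bigr _ (fun j _ => hr j)).
  rewrite big_split sumrB -!scaler_sumr /E !scalerBr.
  set x1 := _ *: A _; set x3 := _ *: A _; set x2 := _ *: A _.
  set y1 := _ *: S _; set y3 := _ *: S _; set y2 := _ *: S _.
  set z1 := (a - 1)%:~R *: \sum_j _; set z2 := (b * _) *: \sum_j _; set z3 := _ *: \sum_j _.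
  move=> h; transitivity ((x1 - x2 + x3) - (y1 - y2 + y3) - (z1 - z2 + z3)).
    rewrite !opprD !opprK.
    by rewrite (AC (3*3*3) ((1*4*7)*(2*5*8)*(3*6*9)))%AC.
  by rewrite h subrr.
(* With E (a - 1) = b E a the factor is b (a - 1) - b a + (m + 2) b = (m + 1) b, which is nonzero in
   characteristic zero. *)
move: hlin; rewrite (step b a rb) !scalerA -scalerBl -scalerDl => /eqP.
rewrite scaler_eq0 => /orP [|/eqP //].
rewrite (_ : _ + _ = b * m.+1%:R); first by rewrite mulf_eq0 (negPf b0) pnatr_eq0.
rewrite intrB -[m.+2]addn1 natrD; ring.
Qed.

(** * Two expansions of one rational function *)

Section RationalPairs.
Context {K : numClosedFieldType} {U : lmodType K}.
Implicit Types (f h : nat -> U) (P X Y C : int -> U) (p q : {poly K}).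

(* X and z^(-N) f are expansions, in t at 0 or infinity and in z at t = e^z,
   of one rational function of t with numerator q X and denominator q. *)
Definition rational_pair (N : nat) X f := exists2 q, q != 0 &
  fin_supp (poly_act (@tmul U) q X) /\ poly_act (expmul 1) q f = zmul N (exp_eval (poly_act
    (@tmul U) q X)).

Lemma poly_actC_mul (V : lmodType K) (T : V -> V) p q x : linear T ->
  poly_act T p (poly_act T q x) = poly_act T q (poly_act T p x).
Proof. by move=> hT; rewrite -!poly_actM // mulrC. Qed.

Let Lt : linear (tmul : (int -> U) -> int -> U) := @tmul_lin K U.
Let Le : linear (expmul 1 : (nat -> U) -> nat -> U) := @expmul_linear K U 1.

Lemma rational_pair_mul N X f p : rational_pair N X f -> rational_pair N (poly_act (@tmul U) p X)
  (poly_act (expmul 1) p f).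
Proof.
move=> [q q0 [h1 h2]]; exists q => //; rewrite !(poly_actC_mul q p) //.
split; first exact: fin_supp_poly_act.
by rewrite h2 poly_act_expmul_zmul (exp_eval_poly_act p h1).
Qed.

Lemma rational_pair_div N X f p : p != 0 ->
  rational_pair N (poly_act (@tmul U) p X) (poly_act (expmul 1) p f) -> rational_pair N X f.
Proof.
move=> p0 [q q0]; rewrite -!poly_actM // => h; exists (q * p) => //.
by rewrite mulf_neq0.
Qed.

Lemma rational_pair_fin_supp N P : fin_supp P -> rational_pair N P (zmul N (exp_eval P)).
Proof. by move=> h; exists 1; rewrite ?oner_neq0 // -polyC1 !poly_actC !scale1r. Qed.

Lemma rational_pairD N X Y f h : rational_pair N X f -> rational_pair N Y h -> rational_pair N (X
  + Y) (f + h).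
Proof.
move=> [q q0 [q1 q2]] [p p0 [p1 p2]]; exists (p * q); first by rewrite mulf_neq0.
have eX : poly_act (@tmul U) (p * q) (X + Y) =
    poly_act (@tmul U) p (poly_act (@tmul U) q X) + poly_act (@tmul U) q (poly_act (@tmul U) p Y).
  by rewrite (poly_actD Lt) poly_actM // mulrC poly_actM.
rewrite eX; have h1 := fin_supp_poly_act p q1; have h2 := fin_supp_poly_act q p1.
split; first exact: fin_suppD.
rewrite (exp_evalD h1 h2) (linD (zmul_linear N)) (poly_actD Le) poly_actM // q2 mulrC poly_actM
  // p2.
by rewrite !poly_act_expmul_zmul (exp_eval_poly_act p q1) (exp_eval_poly_act q p1).
Qed.

Lemma rational_pair_sum N r (X : 'I_r -> int -> U) (f : 'I_r -> nat -> U) :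
  (forall i, rational_pair N (X i) (f i)) -> rational_pair N (\sum_i X i) (\sum_i f i).
Proof.
move=> h; apply: (big_ind2 (rational_pair N)) => //.
  have := rational_pair_fin_supp N (@fin_supp0 K U); rewrite exp_eval0 (lin0 (zmul_linear N)).
  by [].
by move=> *; apply: rational_pairD.
Qed.

(** The witness q of the pair is exchanged for any p that makes p X finite: multiply by q and cancel
    q(e^z). This is how the polynomial with roots in chi(G) takes over from that of the module
    axiom. *)
Lemma rational_pair_numerator N X f p : rational_pair N X f -> fin_supp (poly_act (@tmul U) p X)
  ->
  poly_act (expmul 1) p f = zmul N (exp_eval (poly_act (@tmul U) p X)).
Proof.
move=> [q q0 [q1 q2]] hp; apply/eqP; rewrite -subr_eq0; apply/eqP.
apply: (poly_act_expmul_inj q0); rewrite (poly_actB Le) (poly_actC_mul q) // q2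
  !poly_act_expmul_zmul -(exp_eval_poly_act p q1) -(exp_eval_poly_act q hp).
by rewrite (poly_actC_mul q) // subrr.
Qed.

(** The common z-expansion determines the rational function, but X and Y may expand it at different
    points, so they agree only after multiplication by a denominator. *)
Lemma rational_pair_inj N X Y f : rational_pair N X f -> rational_pair N Y f ->
  exists2 q, q != 0 & poly_act (@tmul U) q X = poly_act (@tmul U) q Y.
Proof.
move=> [q q0 [q1 q2]] [p p0 [p1 p2]]; exists (p * q); first by rewrite mulf_neq0.
rewrite poly_actM // mulrC poly_actM //; apply/eqP; rewrite -subr_eq0; apply/eqP;
  apply: exp_eval_inj.
  rewrite -scaleN1r; apply: fin_suppD; first exact: fin_supp_poly_act.
  by apply: fin_suppZ; apply: fin_supp_poly_act.
rewrite exp_evalB; try exact: fin_supp_poly_act.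
apply: (@zmul_inj _ _ N); rewrite (linB (zmul_linear N)) (exp_eval_poly_act p q1)
  (exp_eval_poly_act q p1) -!poly_act_expmul_zmul -q2 -p2.
by rewrite poly_actC_mul // subrr (lin0 (zmul_linear N)).
Qed.

Definition tdiv X : int -> U := fun a => X (a + 1).

(** t^n X(1/t): the exchange of the two variables in total degree n. *)
Definition treflect (n : int) X : int -> U := fun a => X (n - a).

(** The substitution of -z for z in z^(-N) f, with the sign (-1)^(i - N) written as (-1)^(i + N) to
    keep the exponent natural. *)
Definition zneg (N : nat) f : nat -> U := fun i => (-1) ^+ (i + N) *: f i.

Definition revp p : {poly K} := \poly_(k < size p) p`_((size p).-1 - k).

Lemma revp_neq0 p : p != 0 -> revp p != 0.
Proof.
move=> p0; apply/eqP => /(congr1 (fun q : {poly K} => q`_0)) /eqP.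
by rewrite coef_poly coef0 subn0 lt0n size_poly_eq0 p0 -/(lead_coef p) lead_coef_eq0 (negPf p0).
Qed.

(** With [T'] in the role of 1/T, this is T^d p(1/T) for d = [(size p).-1]; a one-sided inverse is
    enough since every power of [T'] is absorbed by T^d. *)
Lemma poly_act_revp (V : lmodType K) (T T' : V -> V) p x : linear T ->
  (forall y, T (T' y) = y) ->
  poly_act T (revp p) x = iter (size p).-1 T (poly_act T' p x).
Proof.
move=> hT hTT; rewrite (@poly_act_widen _ _ T (revp p) _ (size p)); last exact: size_poly.
have hit k : linear (iter k T) by apply: iter_linear.
rewrite [in RHS]/poly_act (lin_sum (hit _)) [RHS](reindex_inj rev_ord_inj) /=.
apply: eq_bigr => k _; rewrite (linZ (hit _)) coef_poly.
have hk := ltn_ord k.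
have e s : (k < s)%N -> (s.-1 = k + (s - k.+1))%N by lia.
rewrite hk; congr (_ *: _); first by rewrite -subn1 -subnDA add1n.
rewrite (e _ hk) iterD; congr iter; elim: (size p - k.+1)%N => //= m IH.
by rewrite -[T (iter _ _ _)]iterS iterSr hTT -IH.
Qed.

Lemma zneg_expmul N f : zneg N (expmul 1 f) = expmul (- 1) (zneg N f).
Proof.
apply/funext => m; rewrite /zneg /expmul /conv scaler_sumr; apply: eq_bigr => i _.
rewrite !scalerA /exp_coef expr1n; congr (_ *: _).
have -> : (m + N = i + (m - i + N))%N by have := ltn_ord i; lia.
rewrite exprD; ring.
Qed.

Lemma zneg_linear N : linear (zneg N).
Proof.
move=> c f g; apply/funext => i.
by rewrite -[RHS]/(c *: zneg N f i + zneg N g i) /zneg scalerDr !scalerA mulrC.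
Qed.

Lemma fin_supp_treflect n P : fin_supp P -> fin_supp (treflect n P).
Proof. by move=> [L hL]; exists (L + `|n|)%N => a /hL; lia. Qed.

Lemma exp_eval_treflect n P : fin_supp P -> expmul n%:~R (zneg 0 (exp_eval P)) = exp_eval
  (treflect n P).
Proof.
move=> [L hL]; apply/funext => m.
have -> : exp_eval (treflect n P) m = \sum_(a \in [set: int]) exp_coef ((n - a)%:~R : K) m *: P a.
  rewrite /exp_eval (reindex_fsbigT (fun a : int => n - a)) /=.
    by apply: eq_fsbigr => a _; rewrite /treflect subKr.
  by exists (fun a : int => n - a) => a; rewrite subKr.
rewrite (@fsum_ord _ _ _ L.*2 (fun i => i%:Z - L%:Z)); first last.
- move=> a h; have {}h : P a != 0 by apply: contraNneq h => ->; rewrite scaler0.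
  by exists (absz (a + L%:Z)); have := hL _ h; lia.
- by move=> i j _ _; lia.
rewrite /expmul /conv /zneg.
under [LHS]eq_bigr do rewrite (exp_evalE _ hL) !scaler_sumr.
rewrite exchange_big; apply: eq_bigr => i _ /=.
rewrite [(n - _)%:~R]intrB -exp_coef_mul scaler_suml; apply: eq_bigr => j _.
by rewrite !scalerA addn0 /exp_coef [(- _%:~R) ^+ _]exprNn -!mulrA.
Qed.

Lemma zneg_zmul N f : zneg N (zmul N f) = zmul N (zneg 0 f).
Proof.
apply/funext => i; rewrite /zneg /zmul; case: ltnP => hi; first by rewrite scaler0.
by rewrite addn0 -{1}(subnK hi) -addnA exprD addnn -muln2 mulnC exprM sqrrN !expr1n mulr1.
Qed.

(** Along t = e^z, passing from t to 1/t changes z to -z, and the factor t^n becomes e^(n z). An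
    expansion at infinity may turn into one at zero, which a rational pair does not record. *)
Lemma rational_pair_treflect N X f (n : int) : rational_pair N X f ->
  rational_pair N (treflect n X) (expmul n%:~R (zneg N f)).
Proof.
move=> [q q0 [q1 q2]]; exists (revp q); first exact: revp_neq0.
have treflectL : linear (treflect n) by [].
have tauL : linear (fun f => expmul n%:~R (zneg N f)).
  by move=> c x y; rewrite zneg_linear expmul_linear.
have -> : poly_act (@tmul U) (revp q) (treflect n X)
    = iter (size q).-1 (@tmul U) (treflect n (poly_act (@tmul U) q X)).
  rewrite (@poly_act_revp _ (@tmul U) tdiv) //; last first.
    by move=> y; apply/funext => a; rewrite /tmul /tdiv subrK.
  congr iter; symmetry; apply: (poly_act_intertwine (T := tdiv) (F := treflect n)) => // y.
  by apply/funext => a; rewrite /treflect /tdiv /tmul opprD addrA.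
have -> : poly_act (expmul 1) (revp q) (expmul n%:~R (zneg N f))
    = iter (size q).-1 (expmul 1) (expmul n%:~R (zneg N (poly_act (expmul 1) q f))).
  rewrite (@poly_act_revp _ (expmul 1) (expmul (- 1))) //; last first.
    by move=> y; rewrite expmul_expmul subrr expmul0.
  congr iter; symmetry.
  apply: (poly_act_intertwine (T := expmul (- 1)) (F := fun f => expmul n%:~R (zneg N f))) => //
    y.
  by rewrite zneg_expmul !expmul_expmul addrC.
rewrite q2 zneg_zmul expmul_zmul exp_eval_treflect //.
have := fin_supp_treflect n q1; set Q := treflect n _; elim: (size q).-1 => [|d IH] hQ //=.
have [h1 h2] := IH hQ; split; first exact: fin_supp_tmul.
by rewrite h2 expmul_zmul (exp_eval_tmul h1).
Qed.

Lemma dilate_poly_act b p X : b != 0 ->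
  dilate b (poly_act (@tmul U) p X) = poly_act (@tmul U) (p \Po (b *: 'X)) (dilate b X).
Proof.
move=> b0; rewrite -(poly_act_scale b) //.
apply: (poly_act_intertwine (F := dilate b)); first exact: dilate_linear.
move=> x; apply/funext => a.
rewrite -[RHS]/(b *: (b ^ (a - 1) *: x (a - 1))) /dilate /tmul scalerA; congr (_ *: _).
by rewrite -{1}(subrK 1 a) expfzDr // expr1z mulrC.
Qed.

Lemma rational_pair_dilate N b p X f : b != 0 -> rational_pair N (dilate b X) f -> fin_supp
  (poly_act (@tmul U) p X) ->
  poly_act (bexpmul b) p f = zmul N (exp_eval (dilate b (poly_act (@tmul U) p X))).
Proof.
move=> b0 hr hp; rewrite poly_act_scale // dilate_poly_act //;
  apply: rational_pair_numerator => //.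
by rewrite -dilate_poly_act //; apply: fin_supp_dilate.
Qed.

End RationalPairs.

(** The lower bound excludes delta(t / b), which t - b kills: from a zero coefficient the recursion
    propagates zeros upwards. *)
Lemma tmul_inj (K : closedFieldType) (U : lmodType K) (X : int -> U) (p : {poly K}) :
  p != 0 -> (exists L : int, forall a, a < L -> X a = 0) ->
  poly_act (@tmul U) p X = 0 -> X = 0.
Proof.
move=> p0 hX; apply: (@poly_act_inj _ _ (@tmul U)
    (fun X => exists L : int, forall a, a < L -> X a = 0)) => //.
- move=> b x [L hL]; exists L => a ha.
  rewrite -[LHS]/(x (a - 1) - b *: x a) !hL ?scaler0 ?subr0 //; lia.
- move=> b x [L hL] hx.
  have hx' a : x (a - 1) = b *: x a by rewrite -[LHS]/(tmul x a) hx.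
  have [b0|b0] := eqVneq b 0.
    by apply/funext => a; rewrite -[a](addrK 1) hx' b0 scale0r.
  have H n : x (L - 1 + n%:Z) = 0.
    elim: n => [|n IH]; first by rewrite hL //; lia.
    apply: (scalerI b0); rewrite -hx' scaler0 -IH; congr x; lia.
  apply/funext => a; have [/hL //|ha] := ltP a L.
  by rewrite -[RHS](H (absz (a - L + 1))); congr x; lia.
Qed.

(** * Products of formal series *)

Section FormalProducts.
Context {K : fieldType} {U : lmodType K}.

(** Formal products associate when the double sum at the exponent e is finite: [s] contains the
    exponents taken from h1, and [t] the total exponents taken from h1 and h2. *)
Lemma fmulA (E : zmodType) (h1 h2 : E -> K) (X : E -> U) (e : E) (s t : seq E) :
  uniq s -> uniq t ->
  (forall d g, h1 d != 0 -> h2 (g - d) != 0 -> X (e - g) != 0 -> d \in s /\ g \in t) ->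
  fmul h1 (fmul h2 X) e = fmul (fmul (U := K^o) h1 h2) X e.
Proof.
move=> us ut hst; rewrite /fmul.
have inner d : \sum_(d' \in [set: E]) h2 d' *: X (e - d - d')
    = \sum_(g \in [set: E]) h2 (g - d) *: X (e - g).
  rewrite (reindex_fsbigT (fun g => g - d)) /=.
    by apply: eq_fsbigr => g _; rewrite -addrA -opprD subrKC.
  by exists (fun g => g + d) => g; rewrite ?addrK ?subrK.
have h1in d : h1 d *: \sum_(d' \in [set: E]) h2 d' *: X (e - d - d')
    = \sum_(g <- t) (h1 d * h2 (g - d)) *: X (e - g).
  have [->|hd] := eqVneq (h1 d) 0.
    by rewrite scale0r big1 // => g _; rewrite mul0r scale0r.
  rewrite inner (@fsum_seq _ _ _ t) //.
    by rewrite scaler_sumr; apply: eq_bigr => g _; rewrite scalerA.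
  move=> g; rewrite scaler_eq0 negb_or => /andP [h2g Xg].
  by have [] := hst d g hd h2g Xg.
rewrite (@fsum_seq _ _ _ s) //; last first.
  move=> d; rewrite h1in; apply: contraR => ds; rewrite big1 // => g _; apply/eqP.
  apply: contraR ds; rewrite scaler_eq0 mulf_eq0 !negb_or => /andP [/andP [a1 a2] a3].
  by have [] := hst d g a1 a2 a3.
under eq_bigr do rewrite h1in.
rewrite exchange_big /= (@fsum_seq _ _ _ t) //; last first.
  move=> g; rewrite scaler_eq0 negb_or => /andP [hs Xg].
  have [d hd] := fsum_neq0 hs.
  move: hd; rewrite -[_ *: _]/(h1 d * h2 (g - d)) mulf_eq0 negb_or => /andP [a1 a2].
  by have [] := hst d g a1 a2 Xg.
apply: eq_bigr => g _; have [->|Xg] := eqVneq (X (e - g)) 0.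
  by rewrite scaler0 big1 // => d _; rewrite scaler0.
rewrite -scaler_suml (@fsum_seq _ _ _ s) // => d.
rewrite -[_ *: _]/(h1 d * h2 (g - d)) mulf_eq0 negb_or => /andP [a1 a2].
by have [] := hst d g a1 a2 Xg.
Qed.

(** V((x2))((x1)), the analogue of [laurent21] with vector coefficients. *)
Definition trunc21 (V : zmodType) (X : int * int -> V) : Prop :=
  (exists N : int, forall a b, a < N -> X (a, b) = 0) /\
  (forall a, truncated (fun b => X (a, b))).

Lemma trunc21_unif (V : zmodType) (X : int * int -> V) (M : int) : trunc21 X ->
  exists B : int, forall a b, a <= M -> b < B -> X (a, b) = 0.
Proof.
move=> [[N hN] hX].
suff: forall n : nat, exists B : int, forall a b, a < N + n%:Z -> b < B -> X (a, b) = 0.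
  move=> /(_ (absz (M - N)).+1) [B hB]; exists B => a b ha; apply: hB; lia.
elim=> [|n [B hB]]; first by exists 0 => a b ha _; apply: hN; lia.
have [B' hB'] := hX (N + n%:Z); exists (Num.min B B') => a b ha hb.
have [h|h] := ltP a (N + n%:Z); first by apply: hB => //; lia.
have -> : a = N + n%:Z by lia.
by apply: hB'; lia.
Qed.

Definition box (L : nat) : seq (int * int) :=
  [seq (i%:Z - L%:Z, j%:Z - L%:Z) | i <- iota 0 L.*2, j <- iota 0 L.*2].

Lemma box_uniq L : uniq (box L).
Proof.
apply: allpairs_uniq; rewrite ?iota_uniq // => -[i j] [i' j'] _ _ /= [].
by move=> h1 h2; congr (_, _); lia.
Qed.

Lemma mem_box L a b : (`|a| < L)%N -> (`|b| < L)%N -> (a, b) \in box L.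
Proof.
move=> ha hb; apply/allpairsP; exists (absz (a + L%:Z), absz (b + L%:Z)) => /=.
by rewrite !mem_iota; split; [lia | lia | congr (_, _); lia].
Qed.

(** At a fixed e the lower bounds on the x1-exponents of the three factors also bound them above; on
    that finite range the x2-exponents have uniform lower bounds, so everything lies in a box. *)
Lemma fmulA21 (h1 h2 : int * int -> K) (X : int * int -> U) e :
  trunc21 h1 -> trunc21 h2 -> trunc21 X ->
  fmul h1 (fmul h2 X) e = fmul (fmul (U := K^o) h1 h2) X e.
Proof.
move=> t1 t2 t3; case: e => e1 e2.
have [[N1 hN1] _] := t1; have [[N2 hN2] _] := t2; have [[N3 hN3] _] := t3.
have [B1 hB1] := trunc21_unif (e1 - N3 - N2) t1.
have [B2 hB2] := trunc21_unif (e1 - N3 - N1) t2.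
have [B3 hB3] := trunc21_unif (e1 - N1 - N2) t3.
pose L := (`|e1| + `|e2| + `|N1| + `|N2| + `|N3| + `|B1| + `|B2| + `|B3|).+1%N.
apply: (@fmulA _ _ _ _ _ (box L) (box L)); rewrite ?box_uniq // => -[d1 d2] [g1 g2] n1 n2 n3.
have a1 : N1 <= d1 by rewrite leNgt; apply: contra n1 => /hN1 ->.
have a2 : N2 <= g1 - d1 by rewrite leNgt; apply: contra n2 => h; rewrite hN2.
have a3 : N3 <= e1 - g1 by rewrite leNgt; apply: contra n3 => h; rewrite hN3.
have b1 : B1 <= d2 by rewrite leNgt; apply: contra n1 => h; rewrite hB1 //; lia.
have b2 : B2 <= g2 - d2 by rewrite leNgt; apply: contra n2 => h;
  rewrite (hB2 (g1 - d1) (g2 - d2)) //; lia.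
have b3 : B3 <= e2 - g2 by rewrite leNgt; apply: contra n3 => h;
  rewrite (hB3 (e1 - g1) (e2 - g2)) //; lia.
by split; apply: mem_box; rewrite /L; lia.
Qed.

Lemma trunc21_fmul (h : int * int -> K) (X : int * int -> U) :
  trunc21 h -> trunc21 X -> trunc21 (fmul h X).
Proof.
move=> t1 t2; have [[N1 hN1] _] := t1; have [[N2 hN2] _] := t2; split.
  exists (N1 + N2) => a b ha; apply: fsum_eq0 => -[d1 d2].
  have [h1|h1] := ltP d1 N1; first by rewrite hN1 // scale0r.
  by rewrite (hN2 (a - d1) (b - d2)) ?scaler0 //=; lia.
move=> a; have [B1 hB1] := trunc21_unif (a - N2) t1; have [B2 hB2] := trunc21_unif (a - N1) t2.
exists (B1 + B2) => b hb; apply: fsum_eq0 => -[d1 d2].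
have [h1|h1] := ltP d1 N1; first by rewrite hN1 // scale0r.
have [h2|h2] := ltP (a - d1) N2; first by rewrite hN2 ?scaler0.
have [h3|h3] := ltP d2 B1; first by rewrite hB1 ?scale0r //; lia.
by rewrite (hB2 (a - d1) (b - d2)) ?scaler0 //=; lia.
Qed.

Lemma trunc21_sum r (X : 'I_r -> int * int -> U) :
  (forall i, trunc21 (X i)) -> trunc21 (fun d => \sum_(i < r) X i d).
Proof.
elim: r X => [|r IH] X hX.
  by split=> [|a]; exists 0 => *; rewrite big_ord0.
have [[N hN] h1] := IH (fun i => X (widen_ord (leqnSn r) i)) (fun i => hX _).
have [[N' hN'] h2] := hX ord_max; split.
  by exists (Num.min N N') => a b ha; rewrite big_ord_recr /= hN ?hN' ?addr0 //; lia.
move=> a; have [B hB] := h1 a; have [B' hB'] := h2 a.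
by exists (Num.min B B') => b hb; rewrite big_ord_recr /= hB ?hB' ?addr0 //; lia.
Qed.

End FormalProducts.

(** * Products with p(e^z) and p(x1 / x2) as actions of p *)

Section OneVariable.
Context {K : numClosedFieldType} {U : lmodType K}.

Lemma fmul_conv (psi : int -> K) (F : int -> U) (N m : nat) :
  (forall n, n < 0 -> psi n = 0) -> (forall c, c < - N%:Z -> F c = 0) ->
  fmul psi F (m%:Z - N%:Z)
  = conv (fun i => psi i%:Z) (fun i : nat => F (i%:Z - N%:Z)) m.
Proof.
move=> hpsi hF; rewrite /fmul (@fsum_ord _ _ _ m.+1 Posz) /=; first last.
- move=> d; rewrite scaler_eq0 negb_or => /andP [h1 h2].
  have d0 : 0 <= d by rewrite leNgt; apply: contra h1 => h; rewrite hpsi.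
  have dm : - N%:Z <= m%:Z - N%:Z - d by rewrite leNgt; apply: contra h2 => h; rewrite hF.
  by exists (absz d); lia.
- by move=> i j _ _ [].
apply: eq_bigr => i _; congr (_ *: F _); have := ltn_ord i; lia.
Qed.

Lemma fmul_vanish_below (psi : int -> K) (F : int -> U) (N c : int) :
  (forall n, n < 0 -> psi n = 0) -> (forall c, c < N -> F c = 0) ->
  c < N -> fmul psi F c = 0.
Proof.
move=> hpsi hF hc; apply: fsum_eq0 => d.
have [h|h] := ltP d 0; first by rewrite hpsi ?scale0r.
by rewrite hF ?scaler0 //; lia.
Qed.

Lemma poly_exp_lt0 (p : {poly K}) n : n < 0 -> poly_exp p n = 0.
Proof.
by case: n => // n _; rewrite /poly_exp big1 // => k _; rewrite mulr0.
Qed.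

Lemma conv_poly_exp (p : {poly K}) (f : nat -> U) :
  conv (fun i => poly_exp p i%:Z) f = poly_act (expmul 1) p f.
Proof.
apply/funext => m; rewrite /poly_act fct_sumE /conv.
under eq_bigr => i _ do rewrite /poly_exp scaler_suml.
rewrite exchange_big; apply: eq_bigr => k _ /=.
rewrite iter_expmul fctE /expmul /conv scaler_sumr; apply: eq_bigr => i _.
by rewrite scalerA.
Qed.

Lemma fmul_poly_exp (p : {poly K}) (F : int -> U) (N m : nat) :
  (forall c, c < - N%:Z -> F c = 0) ->
  fmul (poly_exp p) F (m%:Z - N%:Z)
  = poly_act (expmul 1) p (fun i : nat => F (i%:Z - N%:Z)) m.
Proof.
move=> hF; rewrite fmul_conv //; first by rewrite conv_poly_exp.
exact: poly_exp_lt0.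
Qed.

Lemma fmul_poly_ratio (p : {poly K}) (X : int * int -> U) (a b : int) :
  fmul (poly_ratio p) X (a, b) = poly_act (@tmul U) p (fun a' => X (a', a + b - a')) a.
Proof.
rewrite /fmul (@fsum_ord _ _ _ (size p) (fun k => (k%:Z, - k%:Z))) /=; first last.
- move=> [d1 d2]; rewrite scaler_eq0 negb_or => /andP [h _]; move: h.
  rewrite /poly_ratio; case: d1 => [k|k]; last by move/eqP. case: (k%:Z + d2 =P 0) => [e hk|_
    /eqP //].
  exists k; first by rewrite ltnNge; apply: contra hk => hk; rewrite nth_default.
  by congr (_, _); lia.
- by move=> i j _ _ [].
rewrite /poly_act fct_sumE; apply: eq_bigr => k _; rewrite subrr eqxx fctE; congr (_ *: _).
have -> : forall (k : nat) (Y : int -> U) a, iter k (@tmul U) Y a = Y (a - k%:Z).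
  by elim=> [|{}k IH] Y x /=; rewrite ?subr0 // /tmul IH; congr Y; lia.
by rewrite -[(a, b) - _]/(a - k%:Z, b - - k%:Z); congr (X (_, _));
   rewrite opprK opprB [a + b]addrC addrACA subrr addr0.
Qed.

End OneVariable.

(** * Division of Laurent series and expansion of f(x1 / x2) *)

Section Division.
Context {K : numClosedFieldType}.
Implicit Types (psi g h : nat -> K).

(** Long division: the first n coefficients of g / psi, kept in a list because each one depends on
    all the earlier ones. *)
Fixpoint quot_prefix psi g n : seq K :=
  if n is m.+1 then
    let s := quot_prefix psi g m in
    rcons s ((g m - \sum_(i < m) psi (m - i)%N * s`_i) / psi 0%N)
  else [::].

Lemma size_quot_prefix psi g n : size (quot_prefix psi g n) = n.
Proof. by elim: n => //= n IH; rewrite size_rcons IH. Qed.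

Lemma nth_quot_prefix psi g n i : (i < n)%N ->
  (quot_prefix psi g n)`_i = (quot_prefix psi g i.+1)`_i.
Proof.
elim: n => // n IH; rewrite ltnS leq_eqVlt => /orP [/eqP -> //|hi].
by rewrite [in LHS]/= nth_rcons size_quot_prefix hi IH.
Qed.

Lemma conv_div_unit psi g : psi 0%N != 0 ->
  exists h : nat -> K, conv (U := K^o) psi h = g.
Proof.
move=> p0; exists (fun i => (quot_prefix psi g i.+1)`_i); apply/funext => m.
rewrite /conv (reindex_inj rev_ord_inj) big_ord_recr /= subSS subnn subn0.
rewrite nth_rcons size_quot_prefix ltnn eqxx.
rewrite -[X in _ + X]/(psi 0%N * _) mulrC divfK // addrCA -[RHS]addr0; congr (_ + _).
apply/eqP; rewrite subr_eq0; apply/eqP; apply: eq_bigr => i _; have hi := ltn_ord i.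
rewrite -[_ *: _]/(_ * _) subSS (nth_quot_prefix _ _ hi).
by rewrite (_ : (m - (m - i) = i)%N) // subKn // ltnW.
Qed.

(** Here psi is z^n times a unit, so h is z^n g / psi and the true quotient has shift n. *)
Lemma conv_div psi g n : psi n != 0 -> (forall i, (i < n)%N -> psi i = 0) ->
  exists h : nat -> K, conv (U := K^o) psi h = zmul n g.
Proof.
move=> pn hn; have [|h hh] := @conv_div_unit (fun i => psi (i + n)%N) g; first by rewrite add0n.
exists h; rewrite -hh; apply/funext => m; rewrite /zmul /conv; case: ltnP => hm.
  by apply: big1 => i _; rewrite hn ?scale0r //; have := ltn_ord i; lia.
rewrite -(big_mkord xpredT (fun i => psi i *: (h (m - i)%N : K^o))).
rewrite (big_cat_nat (n := n)) //=; last by lia.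
rewrite big_nat_cond big1 ?add0r => [|i /andP [/andP [_ hi] _]]; last by rewrite hn ?scale0r.
rewrite -{1}[n]add0n big_addn subSn // big_mkord; apply: eq_bigr => i _.
by congr (_ *: _); congr h; lia.
Qed.

Lemma laurent_div (psi g : int -> K) : (forall n, n < 0 -> psi n = 0) ->
  (forall n, n < 0 -> g n = 0) -> (exists n, psi n != 0) ->
  exists phi : int -> K, truncated phi /\ fmul (U := K^o) psi phi = g.
Proof.
move=> psi0 g0 [n0 hn0].
have [N [hN hmin]] : exists N : nat, psi N%:Z != 0 /\ forall i, (i < N)%N -> psi i%:Z = 0.
  have ex : exists n, psi n%:Z != 0.
    case: n0 hn0 => n hn; first by exists n.
    by rewrite psi0 ?eqxx in hn.
  case: (ex_minnP ex) => N hN hm; exists N; split=> // i hi.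
  by apply/eqP; apply: contraTT hi => /hm; rewrite -leqNgt.
have [h hh] := @conv_div (fun i => psi i%:Z) (fun i => g i%:Z) N hN hmin.
pose phi c : K := if c + N%:Z < 0 then 0 else h (absz (c + N%:Z)).
have phi0 c : c < - N%:Z -> phi c = 0 by move=> hc; rewrite /phi ifT //; lia.
exists phi; split; first by exists (- N%:Z).
apply/funext => c; have [hc|hc] := ltP c (- N%:Z).
  by rewrite (@fmul_vanish_below _ K^o psi phi (- N%:Z)) // g0 //; lia.
have -> : c = (absz (c + N%:Z))%:Z - N%:Z by lia.
move: (absz _) => m {hc c}; rewrite fmul_conv //.
rewrite (_ : (fun i : nat => phi (i%:Z - N%:Z)) = h); last first.
  apply/funext => i; rewrite /phi ifF; last by lia.
  by congr h; lia.
rewrite hh /zmul; case: ltnP => hm; first by rewrite g0 //; lia.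
by congr g; lia.
Qed.

Definition pcoef (p : {poly K}) : int -> K := fun n => if n is Posz k then p`_k else 0.

Lemma fmul_pcoef (U : lmodType K) (p : {poly K}) (X : int -> U) a :
  fmul (pcoef p) X a = poly_act (@tmul U) p X a.
Proof.
rewrite /fmul (@fsum_ord _ _ _ (size p) Posz) /=; first last.
- move=> d; rewrite scaler_eq0 negb_or => /andP [h _]; move: h.
  rewrite /pcoef; case: d => [k|k]; last by move/eqP.
  by move=> hk; exists k => //; rewrite ltnNge; apply: contra hk => hk; rewrite nth_default.
- by move=> i j _ _ [].
rewrite /poly_act fct_sumE; apply: eq_bigr => k _; rewrite fctE; congr (_ *: _).
have -> : forall (k : nat) (Y : int -> U) a, iter k (@tmul U) Y a = Y (a - k%:Z).
  by elim=> [|{}k IH] Y x /=; rewrite ?subr0 // /tmul IH; congr Y; lia.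
by [].
Qed.

(** [iota21] is a choice with default 0; once a solution exists, the chosen series has the defining
    properties. *)
Lemma iota21P (P Q : int * int -> K) :
  (exists H, laurent21 H /\ fmul (U := K^o) Q H = P) ->
  laurent21 (iota21 P Q) /\ fmul (U := K^o) Q (iota21 P Q) = P.
Proof. by move=> [H hH]; apply: (@xgetPex _ (fun=> 0) [set H | laurent21 H /\ fmul (U := K^o) Q H
  = P]); exists H. Qed.

Lemma fden_neq0 (f : {fraction {poly K}}) : fden f != 0.
Proof. exact: denom_ratioP. Qed.

(** A function of x1 / x2 has total degree zero, so the quotient is formed in one variable and
    placed on the line a + b = 0. *)
Lemma iota_ratioP (f : {fraction {poly K}}) :
  laurent21 (iota_ratio f) /\
  fmul (U := K^o) (poly_ratio (fden f)) (iota_ratio f) = poly_ratio (fnum f).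
Proof.
apply: iota21P; have D0 := fden_neq0 f.
have [|||phi [[N hN] hphi]] := @laurent_div (pcoef (fden f)) (pcoef (fnum f)).
- by case.
- by case.
- by exists (size (fden f)).-1%:Z; rewrite /pcoef -/(lead_coef _) lead_coef_eq0.
exists (fun d : int * int => if d.1 + d.2 == 0 then phi d.1 else 0); split.
  split=> [|a]; first by exists N => a b ha /=; rewrite hN ?if_same.
  by exists (- a) => b hb /=; rewrite ifF //; lia.
apply/funext => -[a b]; rewrite (@fmul_poly_ratio _ K^o) /=.
have -> : (fun a' => if a' + (a + b - a') == 0 then phi a' else 0)
    = if a + b == 0 then phi else (0 : int -> K^o).
  by apply/funext => x; rewrite addrC subrK; case: ifP.
rewrite /poly_ratio; case: ifP => ab.
  by rewrite -(@fmul_pcoef K^o) hphi; case: a ab => // k ->.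
by rewrite (poly_act0 (@tmul_lin K K^o)); case: a ab => // k ->.
Qed.

(** Multiplication by p(e^z) is injective; it is tested on the constant series 1. *)
Lemma poly_exp_neq0 (p : {poly K}) : p != 0 -> exists n, poly_exp p n != 0.
Proof.
move=> p0; apply/not_existsP => h.
pose e : nat -> K^o := fun i => (i == 0%N)%:R.
have he : poly_act (expmul 1) p e = 0.
  rewrite -conv_poly_exp; apply/funext => m; rewrite /conv big1 // => i _.
  by have /negP/negPn/eqP -> := h i%:Z; rewrite scale0r.
have := congr1 (fun g => g 0%N) (poly_act_expmul_inj p0 he).
by rewrite /e eqxx => /eqP; rewrite oner_eq0.
Qed.

End Division.

(** * Functions of x1 - x2 *)

Section Binomials.
Context {K : numClosedFieldType}.

Local Notation binz := (@binz K).

Lemma binz0 n : binz n 0 = 1.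
Proof. by rewrite /Defs.binz big_ord0 fact0 divr1. Qed.

Lemma binzS n i : binz n i.+1 = binz n i * (n - i%:Z)%:~R / i.+1%:R.
Proof.
rewrite /Defs.binz big_ord_recr /= factS natrM.
have := @factK K i; have : i.+1%:R != 0 :> K by rewrite pnatr_eq0.
by move=> h1 h2; field; rewrite nat1r h1 h2.
Qed.

Lemma binzSl n i : binz (n + 1) i.+1 = (n + 1)%:~R / i.+1%:R * binz n i.
Proof.
rewrite /Defs.binz big_ord_recl /= subr0 factS natrM.
rewrite (eq_bigr (fun j : 'I_i => (n - j%:Z)%:~R)) => [|j _]; last first.
  by congr (_%:~R); rewrite /bump; lia.
have := @factK K i; have : i.+1%:R != 0 :> K by rewrite pnatr_eq0.
by move=> h1 h2; field; rewrite nat1r h1 h2.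
Qed.

Lemma binz_pascal n i : binz (n + 1) i.+1 = binz n i.+1 + binz n i.
Proof.
rewrite binzSl binzS !intrD intrN mulr1z -[i%:~R]/(i%:R).
have : i.+1%:R != 0 :> K by rewrite pnatr_eq0.
by rewrite -nat1r => h; field.
Qed.

Lemma binz_nat (n i : nat) : binz n%:Z i = 'C(n, i)%:R.
Proof.
elim: i => [|i IH]; first by rewrite binz0 bin0.
rewrite binzS IH; have h : i.+1%:R != 0 :> K by rewrite pnatr_eq0.
apply: (mulIf h); rewrite divfK // -natrM mulnC mul_bin_left natrM mulrC.
have [hi|hi] := leqP i n; last by rewrite bin_small // !mulr0.
by congr (_ * _); rewrite -[RHS]/((n - i)%N%:Z%:~R) -subzn.
Qed.

Lemma binz_opp (c : int) i : (-1) ^+ i * binz (- c - 1) i = binz (c + i%:Z) i.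
Proof.
elim: i c => [|i IH] c; first by rewrite !binz0 mulr1.
rewrite binzS (_ : c + i.+1%:Z = c + i%:Z + 1); last by lia.
rewrite binzSl -IH exprS.
have : i.+1%:R != 0 :> K by rewrite pnatr_eq0.
rewrite (_ : - c - 1 - i%:Z = - (c + i%:Z + 1)); last by lia.
by rewrite intrN => h; field; rewrite nat1r h.
Qed.

End Binomials.

Section Differences.
Context {K : numClosedFieldType} {U : lmodType K}.
Implicit Types (X : int * int -> U) (psi phi : int -> K).

Definition x12mul X : int * int -> U := fun '(a, b) => X (a - 1, b) - X (a, b - 1).

Lemma iter_x12mul n X a b : iter n x12mul X (a, b) =
  \sum_(i < n.+1) ((-1) ^+ i * 'C(n, i)%:R : K) *: X (a - (n%:Z - i%:Z), b - i%:Z).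
Proof.
elim: n X a b => [|n IH] X a b.
  by rewrite big_ord1 /= bin0 mulr1 scale1r !subr0.
rewrite iterSr IH; pose G (i : nat) := X (a - (n.+1%:Z - i%:Z), b - i%:Z).
rewrite (eq_bigr (fun i : 'I_n.+1 => ((-1) ^+ i * 'C(n, i)%:R : K) *: G i
    - ((-1) ^+ i * 'C(n, i)%:R : K) *: G i.+1)) => [|i _]; last first.
  by rewrite -scalerBr /= /G; congr (_ *: (X (_, _) - X (_, _))); lia.
rewrite sumrB big_ord_recl [in RHS]big_ord_recl /= !bin0 -addrA; congr (_ + _).
under [in RHS]eq_bigr => i _ do rewrite /bump add1n binS natrD mulrDr scalerDl.
rewrite [RHS]big_split /= [X in _ = X + _]big_ord_recr /= bin_small // mulr0 scale0r addr0.
congr (_ + _); rewrite -sumrN; apply: eq_bigr => i _.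
by rewrite exprS mulN1r mulNr scaleNr /G.
Qed.

Lemma binexp_nat (n : nat) (a b : int) : binexp (K := K) n%:Z (a, b) != 0 ->
  [/\ 0 <= a, 0 <= b & a + b = n%:Z].
Proof.
case: b => [i|i] /=; last by rewrite eqxx.
case: (a + i%:Z =P n%:Z) => [e|_]; last by rewrite eqxx.
rewrite binz_nat => h; split=> //.
have : (i <= n)%N.
  by rewrite leqNgt; apply: contra h => h; rewrite bin_small // mulr0.
lia.
Qed.

Lemma fmul_binexp (n : nat) X e : fmul (binexp n%:Z) X e = iter n x12mul X e.
Proof.
case: e => a b; rewrite iter_x12mul /fmul (@fsum_ord _ _ _ n.+1 (fun i => (n%:Z - i%:Z, i%:Z))).
- apply: eq_bigr => i _; congr (_ *: _).
  by rewrite /= subrK eqxx binz_nat.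
- by move=> i j _ _ [] _ [].
move=> [d1 d2]; rewrite scaler_eq0 negb_or => /andP [/binexp_nat [h1 h2 h3] _].
by exists (absz d2); [lia | congr (_, _); lia].
Qed.

Lemma at_diff_supp psi (a b : int) : (forall n, n < 0 -> psi n = 0) ->
  at_diff psi (a, b) != 0 -> 0 <= a /\ 0 <= b.
Proof.
move=> psi0; rewrite /at_diff mulf_eq0 negb_or => /andP [h1 h2].
have h : 0 <= a + b by rewrite leNgt; apply: contra h1 => h; rewrite psi0.
have e : a + b = (absz (a + b))%:Z by lia.
by move: h2; rewrite e => /binexp_nat [].
Qed.

Lemma trunc21_at_diff psi : (forall n, n < 0 -> psi n = 0) -> trunc21 (at_diff psi).
Proof.
move=> psi0; have h a b : (a < 0) || (b < 0) -> at_diff psi (a, b) = 0.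
  by move=> hab; apply/eqP; apply: contraT => /(at_diff_supp psi0) [h1 h2]; lia.
split=> [|a]; first by exists 0 => a b h0; apply: h; rewrite h0.
by exists 0 => b h0; apply: h; rewrite h0 orbT.
Qed.

(** Only finitely many powers of x1 - x2 reach a given coefficient. Allowing every large L lets
    several such sums be cut at a common length. *)
Lemma fmul_at_diff psi X e : (forall n, n < 0 -> psi n = 0) -> trunc21 X ->
  exists L0, forall L, (L0 <= L)%N ->
    fmul (at_diff psi) X e = \sum_(n < L) psi n%:Z *: iter n x12mul X e.
Proof.
move=> psi0 tX; case: e => e1 e2; have [[N hN] _] := tX.
have [B hB] := trunc21_unif e1 tX.
exists (absz (e1 + e2 - N - B)%R).+1 => L hL.
under eq_bigr do rewrite -fmul_binexp.
have hb (n : nat) d : binexp (K := K) n%:Z d != 0 -> (n < L)%N -> d \in box L.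
  by case: d => d1 d2 /binexp_nat [h1 h2 h3] nL; apply: mem_box; lia.
transitivity (\sum_(d \in [set: int * int])
    \sum_(n < L) psi n%:Z *: (binexp n%:Z d *: X ((e1, e2) - d))).
  apply: eq_fsbigr => -[d1 d2] _; have [->|Xd] := eqVneq (X ((e1, e2) - (d1, d2))) 0.
    by rewrite scaler0 big1 // => n _; rewrite !scaler0.
  have [hd|hd] := eqVneq (at_diff psi (d1, d2)) 0.
    rewrite hd scale0r big1 // => n _; rewrite scalerA.
    have [->|hb0] := eqVneq (binexp (K := K) n%:Z (d1, d2)) 0; first by rewrite mulr0 scale0r.
    have [_ _ hn] := binexp_nat hb0.
    by move: hd; rewrite /at_diff hn => ->; rewrite scale0r.
  have [h1 h2] := at_diff_supp psi0 hd.
  have a1 : N <= e1 - d1.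
    by rewrite leNgt; apply: contra Xd => h; rewrite (hN (e1 - d1) (e2 - d2)).
  have a2 : B <= e2 - d2.
    by rewrite leNgt; apply: contra Xd => h; rewrite (hB (e1 - d1) (e2 - d2)) //; lia.
  have hn : (absz (d1 + d2)%R < L)%N by lia.
  have en : d1 + d2 = (absz (d1 + d2))%:Z by lia.
  rewrite (bigD1 (Ordinal hn)) // big1 ?addr0 => [|n nn].
    by rewrite -[RHS]/(_ + 0) addr0 scalerA /at_diff [in LHS]en.
  rewrite scalerA; have [->|/binexp_nat [_ _ hn']] := eqVneq (binexp (K := K) n%:Z (d1, d2)) 0.
    by rewrite mulr0 scale0r.
  by case/eqP: nn; apply: val_inj; rewrite /= hn'.
rewrite (@fsum_sum _ _ (fun (n : nat) d => psi n%:Z *: (binexp n%:Z d *: X ((e1, e2) - d)))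
    L (box L) (box_uniq L)); last first.
  move=> n d nL; rewrite scalerA scaler_eq0 mulf_eq0 !negb_or => /andP [/andP [_ h] _].
  exact: hb h nL.
apply: eq_bigr => n _; rewrite /fmul (@fsum_seq _ _ _ (box L)) ?box_uniq //; last first.
  move=> d; rewrite scalerA scaler_eq0 mulf_eq0 !negb_or => /andP [/andP [_ h] _].
  exact: hb h (ltn_ord n).
rewrite (@fsum_seq _ _ _ (box L)) ?box_uniq ?scaler_sumr // => d.
rewrite scaler_eq0 negb_or => /andP [h _]; exact: hb h (ltn_ord n).
Qed.

Lemma fmul_bound psi (F : int -> U) c : (forall n, n < 0 -> psi n = 0) -> truncated F ->
  exists L0, forall L, (L0 <= L)%N ->
    fmul psi F c = \sum_(n < L) psi n%:Z *: F (c - n%:Z).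
Proof.
move=> psi0 [N hN]; exists (absz (c - N)%R).+1 => L hL.
rewrite /fmul (@fsum_ord _ _ _ L Posz) //; first by move=> i j _ _ [].
move=> d; rewrite scaler_eq0 negb_or => /andP [h1 h2].
have d0 : 0 <= d by rewrite leNgt; apply: contra h1 => h; rewrite psi0.
have dm : N <= c - d by rewrite leNgt; apply: contra h2 => h; rewrite hN.
by exists (absz d); lia.
Qed.

(* The substitution x2 = x1 - y, expanded in nonnegative powers of x1, where
   x1 is counted from x1^(-n0); exponents of (y, x1). *)
Definition Psi (n0 : nat) X (c : int) (j : nat) : U :=
  \sum_(i < j.+1) ((-1) ^ c * binz (c + i%:Z) i : K) *: X (j%:Z - n0%:Z - i%:Z, c + i%:Z).

Definition above (n0 : nat) X := forall a b, a < - n0%:Z -> X (a, b) = 0.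

Lemma above_iter n0 X n : above n0 X -> above n0 (iter n x12mul X).
Proof.
move=> hX; elim: n => // n IH a b h.
rewrite -[LHS]/(iter n x12mul X (a - 1, b) - iter n x12mul X (a, b - 1)) !IH ?subr0 //; lia.
Qed.

(** Under x2 = x1 - y the factor x1 - x2 becomes y; on coefficients this is Pascal's rule, and
    [above] removes the boundary term. *)
Lemma Psi_x12mul n0 X c j : above n0 X -> Psi n0 (x12mul X) c j = Psi n0 X (c - 1) j.
Proof.
move=> hX; rewrite /Psi; pose G (i : nat) := X (j%:Z - n0%:Z - i%:Z, c + i%:Z - 1).
rewrite (eq_bigr (fun i : 'I_j.+1 => (-1) ^ c *: (binz (c + i%:Z) i *: G i.+1)
   - (-1) ^ c *: (binz (c + i%:Z) i *: G i))) => [|i _]; last first.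
  rewrite -!scalerBr scalerA /= /G; congr (_ *: (X (_, _) - X (_, _))); lia.
rewrite sumrB -!scaler_sumr -scalerBr.
under [RHS]eq_bigr => i _ do rewrite -scalerA.
rewrite -scaler_sumr (_ : (-1) ^ c = - ((-1) ^ (c - 1)) :> K); last first.
  by rewrite -{1}(subrK 1 c) expfzDr ?oppr_eq0 ?oner_eq0 // expr1z mulrN1.
rewrite scaleNr -scalerN opprB; congr (_ *: _).
rewrite big_ord_recl [X in _ - X]big_ord_recr [RHS]big_ord_recl /=.
rewrite [G j.+1]hX; last by lia.
rewrite scaler0 [X in _ - X]addr0 !binz0 -addrA -sumrB; congr (_ + _).
  by rewrite /G; congr (_ *: X (_, _)); lia.
apply: eq_bigr => i _; rewrite /bump add1n -scalerBl.
rewrite (_ : c + i.+1%:Z = c + i%:Z + 1); last by lia.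
rewrite binz_pascal addrK (_ : c - 1 + i.+1%:Z = c + i%:Z); last by lia.
by rewrite /G; congr (_ *: X (_, _)); lia.
Qed.

Lemma Psi_iter n0 X n c j : above n0 X ->
  Psi n0 (iter n x12mul X) c j = Psi n0 X (c - n%:Z) j.
Proof.
move=> hX; elim: n c => [|n IH] c; first by rewrite subr0.
by rewrite /= Psi_x12mul ?IH; [congr Psi; lia | exact: above_iter].
Qed.

Lemma Psi_truncated n0 X j : trunc21 X -> truncated (fun c => Psi n0 X c j).
Proof.
move=> /(trunc21_unif (j%:Z)) [B hB]; exists (B - j%:Z) => c hc; apply: big1 => i _.
by rewrite hB ?scaler0 //; have := ltn_ord i; lia.
Qed.

Lemma exists_common (n : nat) (P : 'I_n -> nat -> Prop) :
  (forall i, exists L0, forall L, (L0 <= L)%N -> P i L) ->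
  exists L0, forall L, (L0 <= L)%N -> forall i, P i L.
Proof.
elim: n P => [|n IH] P h; first by exists 0%N => L _ [].
have [L1 h1] := IH (fun i => P (widen_ord (leqnSn n) i)) (fun i => h _).
have [L2 h2] := h ord_max; exists (maxn L1 L2) => L; rewrite geq_max => /andP [k1 k2] i.
have [hi|hi] := ltnP i n.
  by have := h1 L k1 (Ordinal hi); congr P; apply: val_inj.
by have -> : i = ord_max; [apply: val_inj => /=; have := ltn_ord i; lia | exact: h2].
Qed.

Lemma Psi_at_diff n0 X psi c j : (forall n, n < 0 -> psi n = 0) -> trunc21 X -> above n0 X ->
  Psi n0 (fmul (at_diff psi) X) c j = fmul psi (fun c' => Psi n0 X c' j) c.
Proof.
move=> psi0 tX aX; have [L1 h1] := fmul_bound c psi0 (Psi_truncated n0 j tX).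
have [L2 h2] := exists_common (fun i : 'I_j.+1 =>
  fmul_at_diff (j%:Z - n0%:Z - i%:Z, c + i%:Z) psi0 tX).
rewrite (h1 (maxn L1 L2)) ?leq_maxl // /Psi.
under eq_bigr => i _ do rewrite (h2 (maxn L1 L2) (leq_maxr _ _)) scaler_sumr.
rewrite exchange_big; apply: eq_bigr => n _ /=.
rewrite -[X in _ = _ *: X]/(Psi n0 X (c - n%:Z) j) -Psi_iter // /Psi scaler_sumr.
by apply: eq_bigr => i _; rewrite !scalerA mulrC.
Qed.

End Differences.

(** * Expansion of f(e^(x1 - x2)) in K((x2))((x1)) *)

Section IotaExp.
Context {K : numClosedFieldType}.
Implicit Types (psi phi : int -> K).

(* phi(x1 - x2) expanded in nonnegative powers of x1. *)
Definition diff21 phi : int * int -> K := fun '(a, b) =>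
  if a is Posz i then phi (a + b) * ((-1) ^ b * binz (a + b) i) else 0.

Lemma x12mul_diff21 phi : x12mul (U := K^o) (diff21 phi) = diff21 (fun c => phi (c - 1)).
Proof.
have s1 b : (-1) ^ (b - 1) = - (-1) ^ b :> K.
  by rewrite -{2}(subrK 1 b) [in RHS]expfzDr ?oppr_eq0 ?oner_eq0 // expr1z mulrN1 opprK.
apply/funext => -[a b]; rewrite /x12mul /diff21; case: a => [[|i]|i].
- rewrite (_ : 0%:Z - 1 = Negz 0) // s1 !binz0 !mulr1 sub0r mulrN opprK.
  by congr (phi _ * _); lia.
- rewrite s1 (_ : i.+1%:Z - 1 = i%:Z); last by lia.
  rewrite (_ : i.+1%:Z + (b - 1) = i%:Z + b); last by lia.
  rewrite (_ : i.+1%:Z + b = i%:Z + b + 1); last by lia.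
  rewrite addrK binz_pascal; ring.
- by rewrite (_ : Negz i - 1 = Negz i.+1) ?subr0 //; lia.
Qed.

Lemma iter_x12mul_diff21 n phi :
  iter n (x12mul (U := K^o)) (diff21 phi) = diff21 (fun c => phi (c - n%:Z)).
Proof.
elim: n => [|n IH]; first by congr diff21; apply/funext => c; rewrite subr0.
rewrite iterS IH x12mul_diff21; congr diff21; apply/funext => c; congr phi; lia.
Qed.

Lemma trunc21_diff21 phi : truncated phi -> laurent21 (diff21 phi).
Proof.
move=> [N hN]; split=> [|a]; first by exists 0 => -[].
exists (N - a) => b hb; rewrite /diff21 hN; last by lia.
by case: a hb => i hb //; rewrite mul0r.
Qed.

Lemma fmul_at_diff21 psi phi : (forall n, n < 0 -> psi n = 0) -> truncated phi ->
  fmul (U := K^o) (at_diff psi) (diff21 phi) = diff21 (fmul (U := K^o) psi phi).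
Proof.
move=> psi0 hphi; apply/funext => -[a b].
have [L1 h1] := @fmul_at_diff K K^o psi (diff21 phi) (a, b) psi0 (trunc21_diff21 hphi).
have [L2 h2] := @fmul_bound K K^o psi phi (a + b) psi0 hphi.
rewrite (h1 (maxn L1 L2)) ?leq_maxl // /diff21 (h2 (maxn L1 L2)) ?leq_maxr //.
under eq_bigr => n _ do rewrite iter_x12mul_diff21 /diff21.
case: a {h1 h2} => i; last by rewrite big1 // => n _; rewrite scaler0.
by rewrite mulr_suml; apply: eq_bigr => n _; rewrite -[_ *: _]/(_ * _) mulrA.
Qed.

(** Nonnegative powers of x1 - x2 are polynomials, so the direction of expansion makes no
    difference. *)
Lemma at_diff_diff21 psi : (forall n, n < 0 -> psi n = 0) -> at_diff psi = diff21 psi.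
Proof.
move=> psi0; apply/funext => -[a b]; rewrite /at_diff /diff21.
have [h|h] := ltP (a + b) 0; first by rewrite psi0 // mul0r; case: (a) => // i; rewrite mul0r.
have [n e] : exists n : nat, a + b = n%:Z by exists (absz (a + b)); lia.
rewrite e; case: a e {h} => i e; last first.
  case: b e => j e /=; last by rewrite mulr0.
  by rewrite e eqxx binz_nat bin_small ?mulr0 //; lia.
rewrite binz_nat; case: b e => j e /=; last by rewrite bin_small ?mulr0 //; lia.
rewrite e eqxx binz_nat; have en : n = (i + j)%N by lia.
by rewrite -[in RHS]bin_sub ?en ?leq_addr // addKn.
Qed.

(** The quotient is formed in one variable and then evaluated at x1 - x2 by [diff21], which is
    compatible with products. *)
Lemma iota_expP (f : {fraction {poly K}}) :
  laurent21 (iota_exp f) /\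
  fmul (U := K^o) (at_diff (poly_exp (fden f))) (iota_exp f) = at_diff (poly_exp (fnum f)).
Proof.
apply: iota21P.
have [|||phi [hphi e]] := @laurent_div K (poly_exp (fden f)) (poly_exp (fnum f)).
- exact: poly_exp_lt0.
- exact: poly_exp_lt0.
- exact/poly_exp_neq0/fden_neq0.
exists (diff21 phi); split; first exact: trunc21_diff21.
rewrite fmul_at_diff21 ?e ?at_diff_diff21 //; exact: poly_exp_lt0.
Qed.

End IotaExp.

(** * Skew symmetry *)

Section VertexAlgebra.
Context {K : numClosedFieldType} {V : lmodType K} (one : V) (Y : V -> V -> int -> V).
Context (hV : weak_quantum_va one Y).

(* Y(u, x0 + x2) Y(v, x2) 1 = Y(Y(u, x0) v, x2) 1: apply the Jacobi identity to
   the vacuum and take Res_{x1}; the terms in the opposite order have no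
   negative powers of x1. *)
Lemma assoc_one u v c (b : nat) : Y (Y u v c) one b%:Z =
  \sum_(i < b.+1) (binz (c + i%:Z) i : K) *: Y u (Y v one (b%:Z - i%:Z)) (c + i%:Z).
Proof.
have [hY _ hcr _ hJ] := hV; have [_ lin2 _] := hY.
have Y0 x n : Y x 0 n = 0 := lin0 (lin2 x n).
have [r [u' [v' [f [_ hj]]]]] := hJ u v.
have := hj one (c, -1, b%:Z).
set t1 := fmul _ _ _; set t2 := fmul _ _ _; set t3 := fmul _ _ _.
have -> : t2 = 0.
  apply: fsum_eq0 => -[[c' a'] b']; rewrite /delta_21_0 /lift12 /=.
  case: a' => [i|i]; last by rewrite mulr0 scale0r.
  case: (c - c' == 0); last by rewrite scaler0.
  rewrite big1 ?scaler0 // => k _; apply: fsum_eq0 => -[d1 d2] /=.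
  have [hd|hd] := leP 0 d1; last first.
    by rewrite /at_diff /=; case: d1 hd => // j _; rewrite mulr0 scale0r.
  by rewrite hcr ?Y0 ?scaler0 //; lia.
have -> : t3 = Y (Y u v c) one b%:Z.
  rewrite /t3 /fmul (@fsum_seq _ _ _ [:: (0, -1, 0)]) //.
    rewrite big_seq1 /delta_10_2 /lift02 /= binz0 mulr1 scale1r !subr0.
    by [].
  move=> [[c' a'] b']; rewrite scaler_eq0 negb_or => /andP [h1 h2].
  move: h2; rewrite /lift02 /=; case: ifP => [/eqP ha _|_]; last by rewrite eqxx.
  move: h1; rewrite /delta_10_2 /=; case: c' => [i|i]; last by rewrite eqxx.
  have -> : a' = -1 by lia.
  case: (-1 + i%:Z =P - b' - 1) => [e|_]; last by rewrite eqxx.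
  case: i e => [|i] e.
    by move=> _; rewrite inE; apply/eqP; congr (_, _, _); lia.
  rewrite -e (_ : -1 + i.+1%:Z = i%:Z); last by lia.
  by rewrite binz_nat bin_small // mulr0 eqxx.
rewrite subr0 => <-; rewrite /t1 /fmul.
rewrite (@fsum_ord _ _ _ b.+1 (fun i => (c, - c - 1 - i%:Z, i%:Z))).
- apply: eq_bigr => i _; rewrite /delta_12_0 /lift12 /= subrr eqxx subrK eqxx binz_opp.
  by congr (_ *: Y _ _ _); lia.
- by move=> i j _ _ [] _ [].
move=> [[c' a'] b']; rewrite scaler_eq0 negb_or => /andP [h1 h2].
move: h2; rewrite /lift12 /=; case: ifP => [/eqP hc h2|_]; last by rewrite eqxx.
move: h1; rewrite /delta_12_0 /=; case: b' h2 => [i|i] h2; last by rewrite eqxx.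
case: (a' + i%:Z =P - c' - 1) => [e _|_]; last by rewrite eqxx.
exists i; last by congr (_, _, _); lia.
rewrite ltnS leqNgt; apply: contra h2 => hi; rewrite hcr ?Y0 //; lia.
Qed.

End VertexAlgebra.

(** * Restriction to the diagonal y = x1 *)

Section Diagonal.
Context {K : numClosedFieldType} {U : lmodType K}.

(** The sum of z^j G_j(z): a series in y and x1, with G_j the coefficient of x1^j, at y = x1 = z. *)
Definition diagsum (G : nat -> nat -> U) : nat -> U :=
  fun m => \sum_(j < m.+1) G j (m - j)%N.

(** Multiplication by p(e^z) uses no higher coefficients, so the infinite sum [diagsum] may be cut
    off before p acts. *)
Lemma poly_act_expmul_eq_below (p : {poly K}) (f g : nat -> U) L :
  (forall i, (i < L)%N -> f i = g i) ->
  forall i, (i < L)%N -> poly_act (expmul 1) p f i = poly_act (expmul 1) p g i.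
Proof.
move=> h i hi; apply/eqP; rewrite -subr_eq0; apply/eqP.
rewrite -[LHS]/((poly_act (expmul 1) p f - poly_act (expmul 1) p g) i) -(poly_actB (expmul_linear
  1)).
rewrite (eq_poly_act (T' := fun x => 1 *: expmul 1 x)); last by move=> x; rewrite scale1r.
have [|hl _] := @poly_act_expmul_vanish_below K U 1 p 1 L (f - g); last exact: hl.
by move=> x hx; rewrite -[LHS]/(f x - g x) h ?subrr.
Qed.

Lemma poly_act_diagsum (p : {poly K}) (G : nat -> nat -> U) :
  poly_act (expmul 1) p (diagsum G) = diagsum (fun j => poly_act (expmul 1) p (G j)).
Proof.
have hd (H : nat -> nat -> U) L i : (i < L)%N ->
    diagsum H i = (\sum_(j < L) zmul j (H j)) i.
  move=> hi; rewrite fct_sumE /diagsum (big_ord_widen _ (fun j => H j (i - j)%N) hi).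
  rewrite big_mkcond; apply: eq_bigr => j _; rewrite /zmul ltnS.
  by case: leqP.
apply/funext => m; rewrite (hd _ m.+1) //.
rewrite (poly_act_expmul_eq_below p (g := \sum_(j < m.+1) zmul j (G j)) (L := m.+1)) //;
  last first.
  exact: hd.
rewrite (poly_act_sum (expmul_linear 1)); congr ((_ : nat -> U) m).
by apply: eq_bigr => j _; rewrite poly_act_expmul_zmul.
Qed.

Lemma truncated_nat (F : int -> U) : truncated F ->
  exists N0 : nat, forall N, (N0 <= N)%N -> forall c, c < - N%:Z -> F c = 0.
Proof. by move=> [M hM]; exists (absz M) => N hN c hc; apply: hM; lia. Qed.

Lemma fmul_poly_exp_mul (D N q : {poly K}) (F G : int -> U) :
  truncated F -> truncated G ->
  (forall c, fmul (poly_exp D) F c = fmul (poly_exp N) G c) ->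
  forall c, fmul (poly_exp (q * D)) F c = fmul (poly_exp (q * N)) G c.
Proof.
move=> /truncated_nat [M1 h1] /truncated_nat [M2 h2] h c.
have {}h1 := h1 (maxn M1 M2) (leq_maxl _ _); have {}h2 := h2 (maxn M1 M2) (leq_maxr _ _).
move: (maxn M1 M2) h1 h2 => M h1 h2.
have [hc|hc] := ltP c (- M%:Z).
  rewrite (fmul_vanish_below (@poly_exp_lt0 K _) h1 hc) (fmul_vanish_below (@poly_exp_lt0 K _) h2
    hc) //.
have -> : c = (absz (c + M%:Z))%:Z - M%:Z by lia.
rewrite !fmul_poly_exp // !(poly_actM (expmul_linear 1)).
suff -> : poly_act (expmul 1) D (fun i : nat => F (i%:Z - M%:Z))
  = poly_act (expmul 1) N (fun i : nat => G (i%:Z - M%:Z)) by [].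
by apply/funext => m; rewrite -!fmul_poly_exp.
Qed.

End Diagonal.

Section SkewSymmetry.
Context {K : numClosedFieldType} {V : lmodType K} (one : V) (Y : V -> V -> int -> V).
Context (hV : weak_quantum_va one Y) (u v : V) (r : nat) (u' v' : 'I_r -> V)
  (f : 'I_r -> {fraction {poly K}}) (k : nat) (hrel : T_relation Y u v u' v' f k).

Let A := YY Y u v one.
Let B i := swap (YY Y (v' i) (u' i) one).
Let X i := fmul (iota_exp (f i)) (B i).

Lemma Y_arg0 x n : Y x 0 n = 0.
Proof. by have [[_ h _] _ _ _ _] := hV; apply: lin0 (h x n). Qed.

Lemma trunc21_B i : trunc21 (B i).
Proof.
have [[_ _ htr] _ hcr _ _] := hV; split=> [|a]; last exact: htr.
by exists 0 => a b ha; rewrite /B /= hcr ?Y_arg0.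
Qed.

Lemma above_B n0 i : above n0 (B i).
Proof.
have [_ _ hcr _ _] := hV => a b ha; rewrite /B /= hcr ?Y_arg0 //; lia.
Qed.

(** With x2 = x1 - y, [assoc_one] at x0 = -y turns Y(v_i,x2) Y(u_i,x1) 1 into Y(Y(v_i,-y) u_i, x1)
    1; hence the sign, and the zeros before x1^0, which has index n0. *)
Lemma Psi_B n0 i c j : Psi n0 (B i) c j =
  if (j < n0)%N then 0
  else (-1) ^ c *: Y (Y (v' i) (u' i) c) one (j - n0)%N%:Z.
Proof.
have [_ _ hcr _ _] := hV; rewrite /Psi; case: ltnP => hj.
  by apply: big1 => l _; rewrite /B /= hcr ?Y_arg0 ?scaler0 //; lia.
rewrite (assoc_one hV) scaler_sumr.
rewrite (big_ord_widen j.+1 (fun l => (-1) ^ c *: ((binz (c + l%:Z) l : K) *: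
   Y (v' i) (Y (u' i) one ((j - n0)%N%:Z - l%:Z)) (c + l%:Z)))); last by lia.
rewrite [RHS]big_mkcond /=; apply: eq_bigr => l _; rewrite scalerA /B /=.
rewrite subzn //; case: ltnP => // hl.
by rewrite hcr ?Y_arg0 ?scaler0 //; lia.
Qed.

Lemma trunc21_X i : trunc21 (X i).
Proof. by apply: trunc21_fmul; [have [] := iota_expP (f i) | exact: trunc21_B]. Qed.

Lemma Psi_X n0 i j c : above n0 (X i) ->
  fmul (poly_exp (fden (f i))) (fun c => Psi n0 (X i) c j) c
  = fmul (poly_exp (fnum (f i))) (fun c => Psi n0 (B i) c j) c.
Proof.
move=> hX; have [h1 h2] := iota_expP (f i).
have p0 := @poly_exp_lt0 K.
rewrite -(Psi_at_diff c j (p0 (fden (f i))) (trunc21_X i) hX).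
rewrite -(Psi_at_diff c j (p0 (fnum (f i))) (trunc21_B i) (above_B i)).
congr Psi; apply/funext => e.
by rewrite /X (fmulA21 e (trunc21_at_diff (p0 _)) h1 (trunc21_B i)) h2.
Qed.

Definition common_den : {poly K} := \prod_i fden (f i).

Definition cofactor_num i : {poly K} := (\prod_(j | j != i) fden (f j)) * fnum (f i).

Lemma common_denE i : common_den = (\prod_(j | j != i) fden (f j)) * fden (f i).
Proof. by rewrite /common_den (bigD1 i) //= mulrC. Qed.

Lemma common_den_neq0 : common_den != 0.
Proof. by apply/prodf_neq0 => i _; apply: fden_neq0. Qed.

Let Xs d := \sum_(i < r) X i d.

Lemma Psi_Xs n0 j c : (forall i, above n0 (X i)) ->
  fmul (poly_exp common_den) (fun c => Psi n0 Xs c j) c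
  = \sum_i fmul (poly_exp (cofactor_num i)) (fun c => Psi n0 (B i) c j) c.
Proof.
move=> hX; have p0 := @poly_exp_lt0 K.
have -> : (fun c => Psi n0 Xs c j) = (fun c => \sum_(i < r) Psi n0 (X i) c j).
  apply/funext => c0; rewrite /Psi exchange_big; apply: eq_bigr => l _ /=.
  by rewrite /Xs scaler_sumr.
have htr i := Psi_truncated n0 j (trunc21_X i).
have htr' i := Psi_truncated n0 j (trunc21_B i).
transitivity (\sum_i fmul (poly_exp common_den) (fun c => Psi n0 (X i) c j) c).
  have [L h] := exists_common (fun i => fmul_bound c (p0 common_den) (htr i)).
  have htrs : truncated (fun c => \sum_(i < r) Psi n0 (X i) c j).
    have [L' h'] := exists_common (fun i => truncated_nat (htr i)).
    by exists (- L'%:Z) => c0 hc; rewrite big1 // => i _; apply: (h' L') hc.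
  have [L1 h1] := fmul_bound c (p0 common_den) htrs.
  rewrite (h1 (maxn L L1)) ?leq_maxr //.
  under [RHS]eq_bigr => i _ do rewrite (h (maxn L L1) (leq_maxl _ _)).
  by rewrite exchange_big; apply: eq_bigr => n _ /=; rewrite scaler_sumr.
apply: eq_bigr => i _; rewrite (common_denE i) /cofactor_num.
by apply: fmul_poly_exp_mul => // c0; apply: Psi_X.
Qed.


Let P n0 c j := Psi n0 Xs c j.

Lemma iter_x12mul_rel : iter k x12mul A = iter k x12mul Xs.
Proof. by apply/funext => e; rewrite -!fmul_binexp; apply: hrel. Qed.

Lemma above_Xs n0 : (forall i, above n0 (X i)) -> above n0 Xs.
Proof. by move=> h a b ha; apply: big1 => i _; apply: h. Qed.

Lemma A_neg a b : b < 0 -> A (a, b) = 0.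
Proof. by have [_ _ hcr _ _] := hV => hb; rewrite /A /= hcr ?Y_arg0. Qed.

Lemma rel_neg a b : b < 0 -> iter k x12mul A (a, b) = 0.
Proof.
by move=> hb; rewrite iter_x12mul big1 // => i _; rewrite A_neg ?scaler0 //; lia.
Qed.

Lemma rel_0 a : iter k x12mul A (a, 0) = Y u v (a - k%:Z).
Proof.
have [_ _ _ hlim _] := hV.
rewrite iter_x12mul big_ord_recl big1 => [|i _]; last first.
  by rewrite A_neg ?scaler0 //= /bump; lia.
by rewrite bin0 expr0 mulr1 scale1r addr0 /A /= !subr0 hlim.
Qed.

(** After multiplication by (x1 - x2)^k = y^k the series equals one in nonnegative powers of x2, and
    those produce only nonnegative powers of y. *)
Lemma P_vanish_below n0 c j : (forall i, above n0 (X i)) -> c < - k%:Z -> P n0 c j = 0.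
Proof.
move=> hX hc; have -> : c = c + k%:Z - k%:Z by rewrite addrK.
rewrite /P -(Psi_iter _ _ _ (above_Xs hX)) -iter_x12mul_rel /Psi; apply: big1 => i _.
have [h|h] := ltP (c + k%:Z + i%:Z) 0; first by rewrite rel_neg ?scaler0.
have -> : c + k%:Z + i%:Z = (absz (c + k%:Z + i%:Z))%:Z by lia.
by rewrite binz_nat bin_small ?mulr0 ?scale0r //; lia.
Qed.

Lemma sum_alt_bin n : \sum_(i < n.+1) ((-1) ^+ (n - i) * 'C(n, i)%:R : K) = (n == 0%N)%:R.
Proof.
have := exprDn (-1 : K) 1 n; rewrite addNr expr0n => ->; apply: eq_bigr => i _.
by rewrite expr1n mulr1 mulr_natr.
Qed.

(* Setting x2 = 0 in a series with nonnegative powers of x2 amounts to setting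
   y = x1 after the substitution x2 = x1 - y. *)
Lemma diag_Psi n0 (Q : int * int -> V) M : above n0 Q ->
  (forall a b, b < 0 -> Q (a, b) = 0) ->
  \sum_(j < M.+1) Psi n0 Q (M - j)%N%:Z j = Q (M%:Z - n0%:Z, 0).
Proof.
move=> hQ hQ0; rewrite /Psi.
pose F (i l : nat) : V := ((-1) ^+ (M - (i + l)) * 'C(M - l, i)%:R : K) *: Q (l%:Z - n0%:Z, (M -
  l)%N%:Z).
transitivity (\sum_(j < M.+1) \sum_(i < j.+1) F i (j - i)%N).
  apply: eq_bigr => -[j /=]; rewrite ltnS => hj _; apply: eq_bigr => -[i /=];
    rewrite ltnS => hi _.
  rewrite /F subnKC // -PoszD binz_nat.
  have -> : (M - j + i = M - (j - i))%N by lia.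
  by congr (_ *: Q (_, _)); lia.
rewrite -(sum_triangle F) (eq_bigr (fun i : 'I_M.+1 => \sum_(l < M.+1 | (l < (M - i).+1)%N) F i
  l));
  last by move=> i _; rewrite (big_ord_widen M.+1) // ltnS leq_subr.
under eq_bigr do rewrite big_mkcond /=.
rewrite exchange_big /= big_ord_recr /= big1 ?add0r => [|l _].
  rewrite big_ord_recl /= subn0 ltnS leqnn /F add0n !subnn bin0 mulr1 expr0 scale1r.
  rewrite big1 ?addr0 // => i _; rewrite ifF //.
  by have := ltn_ord i; rewrite /bump; lia.
have hl := ltn_ord l.
rewrite (eq_bigr (fun i : 'I_M.+1 => if (i < (M - l).+1)%N then F i l else 0)); last first.
  by move=> i _; congr (if _ then _ else _); have := ltn_ord i; lia.
rewrite -big_mkcond -(big_ord_widen M.+1 (fun i => F i l)); last by rewrite ltnS leq_subr.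
rewrite /F -scaler_suml.
rewrite (eq_bigr (fun i : 'I_(M - l).+1 => (-1) ^+ (M - l - i) * 'C(M - l, i)%:R)); last first.
  by move=> i _; congr (_ ^+ _ * _); have := ltn_ord i; lia.
by rewrite sum_alt_bin (_ : (M - l == 0)%N = false) ?scale0r //; lia.
Qed.

(* Y(u, z) v = \sum_i f_i(e^z) e^(z D) Y(v_i, -z) u_i with the denominators
   cleared, where e^(z D) a stands for Y(a, z) 1. *)
Lemma skew_symmetry : exists N0 : nat, forall N, (N0 <= N)%N ->
  poly_act (expmul 1) common_den (fun m : nat => Y u v (m%:Z - N%:Z))
  = \sum_i poly_act (expmul 1) (cofactor_num i)
      (diagsum (fun j m => (-1) ^ (m%:Z - N%:Z) *:
                           Y (Y (v' i) (u' i) (m%:Z - N%:Z)) one j%:Z)).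
Proof.
have [[_ lin2 htr] _ hcr _ _] := hV; have [lin1 _ _] := wqva_map hV.
have [n0 hX] : exists n0, forall i, above n0 (X i).
  have [L h] : exists L, forall L', (L <= L')%N -> forall i, above L' (X i).
    apply: exists_common => i; have [[M hM] _] := trunc21_X i.
    by exists (absz M) => L hL a b ha; apply: hM; lia.
  by exists L => i; apply: (h L).
have [N1 hN1] : exists N1, forall N, (N1 <= N)%N -> forall i c, c < - N%:Z -> Y (v' i) (u' i) c =
  0.
  exact: exists_common (fun i => truncated_nat (htr (v' i) (u' i))).
(* N bounds the poles of all Y(v_i,z) u_i and also the order k of the pole in y. *)
exists (maxn N1 k) => N; rewrite geq_max => /andP [/hN1 hN hkN].
have Pl c j : c < - N%:Z -> P n0 c j = 0 by move=> hc; apply: P_vanish_below => //; lia.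
have Bl i c j : c < - N%:Z -> Psi n0 (B i) c j = 0.
  move=> hc; rewrite Psi_B; case: ifP => // _; rewrite hN // .
  by rewrite (lin0 (lin1 one (j - n0)%N%:Z)) scaler0.
have hP j : poly_act (expmul 1) common_den (fun m : nat => P n0 (m%:Z - N%:Z) j)
    = \sum_i poly_act (expmul 1) (cofactor_num i) (fun m : nat => Psi n0 (B i) (m%:Z - N%:Z) j).
  apply/funext => m; rewrite fct_sumE -(fmul_poly_exp common_den m (fun c => Pl c j)).
  rewrite (Psi_Xs j _ hX); apply: eq_bigr => i _.
  by rewrite (fmul_poly_exp (cofactor_num i) m (fun c => Bl i c j)).
(* With the denominator cleared, the right side has no negative powers of x1; the injectivity of
   [common_den] at e^y carries this over to P. *)
have P0 j m : (j < n0)%N -> P n0 (m%:Z - N%:Z) j = 0.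
  move=> hj; have h0 : poly_act (expmul 1) common_den (fun m : nat => P n0 (m%:Z - N%:Z) j) = 0.
    rewrite hP big1 // => i _.
    rewrite (_ : (fun _ => _) = 0) ?(poly_act0 (expmul_linear 1)) //.
    by apply/funext => m'; rewrite Psi_B hj.
  have := congr1 (fun g => g m) (poly_act_expmul_inj common_den_neq0 h0); exact.
(* The multiplied relation has no negative powers of x2; at x2 = 0 its left side is x1^k Y(u,x1) v,
   and [diag_Psi] computes the same value as the diagonal of the right side. *)
have -> : (fun m : nat => Y u v (m%:Z - N%:Z))
    = diagsum (fun j m => P n0 (m%:Z - N%:Z) (n0 + j)%N).
  apply/funext => m; rewrite /diagsum.
  have aQ : above n0 (iter k x12mul A) by rewrite iter_x12mul_rel; apply/above_iter/above_Xs.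
  have -> : m%:Z - N%:Z = (m%:Z - N%:Z + k%:Z) - k%:Z by rewrite addrK.
  rewrite -rel_0; have [hm|hm] := ltP (m%:Z - N%:Z + k%:Z) (- n0%:Z).
    rewrite aQ // big1 // => j _; rewrite P_vanish_below //; have := ltn_ord j; lia.
  have [M eM] : exists M : nat, m%:Z - N%:Z + k%:Z = M%:Z - n0%:Z.
    by exists (absz (m%:Z - N%:Z + k%:Z + n0%:Z)); lia.
  rewrite eM -(diag_Psi M aQ rel_neg) iter_x12mul_rel.
  under eq_bigr => j _ do rewrite (Psi_iter _ _ _ (above_Xs hX)) -/(P _ _ _).
  have P0' j c : (j < n0)%N -> P n0 c j = 0.
    move=> hj; have [hc|hc] := ltP c (- N%:Z); first exact: Pl.
    by have -> : c = (absz (c + N%:Z))%:Z - N%:Z; [lia | exact: P0].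
  (* The added terms have j > M, hence an exponent of y below -k, and vanish. *)
  transitivity (\sum_(j < n0 + m.+1) P n0 (M%:Z - j%:Z - k%:Z) j).
    have hle : (M.+1 <= n0 + m.+1)%N by lia.
    rewrite (eq_bigr (fun j : 'I_M.+1 => P n0 (M%:Z - j%:Z - k%:Z) j)) => [|j _]; last first.
      by congr (P n0 (_ - _) j); have := ltn_ord j; lia.
    rewrite (big_ord_widen _ (fun j => P n0 (M%:Z - j%:Z - k%:Z) j) hle) big_mkcond.
    apply: eq_bigr => j _; case: ltnP => // hj; rewrite P_vanish_below //; lia.
  rewrite big_split_ord big1 /= => [|j _]; last exact: P0'.
  rewrite add0r.
  apply: eq_bigr => j _ /=; congr (P n0 _ _); have := ltn_ord j; lia.
rewrite poly_act_diagsum; under [RHS]eq_bigr do rewrite poly_act_diagsum.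
apply/funext => m; rewrite fct_sumE /diagsum.
under eq_bigr => j _ do rewrite hP fct_sumE.
rewrite exchange_big; apply: eq_bigr => i _ /=.
apply: eq_bigr => j _; congr (poly_act _ _ _ _); apply/funext => m'.
by rewrite Psi_B ltnNge leq_addr /= addKn.
Qed.

End SkewSymmetry.

Lemma sign_sub (K : fieldType) (i N : nat) :
  (-1) ^ (i%:Z - N%:Z) = (-1) ^+ (i + N) :> K.
Proof. by rewrite expfzDr ?oppr_eq0 ?oner_eq0 // -exprz_inv invrN1 exprD. Qed.

(** * Modules *)

Section Module.
Context {K : numClosedFieldType} {V W : lmodType K} (one : V) (Y : V -> V -> int -> V)
  (YW : V -> W -> int -> W) (hV : weak_quantum_va one Y) (hW : phi_quasi_module one Y YW).

(** In total degree n a series in (x1, x) is x^n times a series in t = x1 / x. *)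
Definition deg_part (U : Type) (X : int * int -> U) (n : int) : int -> U :=
  fun a => X (a, n - a).

Lemma fmul_poly_ratio_deg (p : {poly K}) (X : int * int -> W) n :
  deg_part (fmul (poly_ratio p) X) n = poly_act (@tmul W) p (deg_part X n).
Proof.
by apply/funext => a; rewrite /deg_part fmul_poly_ratio addrC subrK.
Qed.

Lemma trunc21_poly_ratio (p : {poly K}) : trunc21 (poly_ratio p).
Proof.
split=> [|a]; first by exists 0 => -[].
exists (- a) => b hb; rewrite /poly_ratio; case: a hb => // a hb.
by rewrite ifF //; lia.
Qed.

Lemma fin_supp_truncated2 (X : int * int -> W) n : truncated2 X -> fin_supp (deg_part X n).
Proof.
move=> [M hM]; exists (absz M + absz n).+1 => a h.
have h1 : M <= a by rewrite leNgt; apply: contra h => h; rewrite /deg_part hM ?h.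
have h2 : M <= n - a by rewrite leNgt; apply: contra h => h; rewrite /deg_part hM ?h ?orbT.
by lia.
Qed.

Lemma YW_arg0 x n : YW x 0 n = 0.
Proof. by have [_ h _] := phim_map hW; apply: lin0 (h x n). Qed.

Lemma rational_pair_YY u v w n N : (forall c, c < - N%:Z -> Y u v c = 0) ->
  rational_pair N (deg_part (YY YW u v w) n) (fun i : nat => YW (Y u v (i%:Z - N%:Z)) w n).
Proof.
move=> hN; have [p [p0 htr hp]] := phim_assoc hW u v.
have [lin1 _ _] := phim_map hW.
have YW0 c : c < - N%:Z -> YW (Y u v c) w n = 0.
  by move=> /hN ->; apply: lin0 (lin1 w n).
have hsup := fin_supp_truncated2 n (htr w); rewrite /pYY fmul_poly_ratio_deg in hsup.
exists p => //; split=> //; apply/funext => m.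
rewrite -(fmul_poly_exp p m YW0).
have -> : fmul (poly_exp p) (fun c => YW (Y u v c) w n) (m%:Z - N%:Z)
    = fmul (lift1 (poly_exp p)) (Yiter Y YW u v w) (m%:Z - N%:Z, n).
  rewrite /fmul (@fsum_ord _ _ _ m.+1 Posz) /=; first last.
  - move=> d; rewrite scaler_eq0 negb_or => /andP [h1 h2].
    have d0 : 0 <= d by rewrite leNgt; apply: contra h1 => h; rewrite poly_exp_lt0.
    have dm : - N%:Z <= m%:Z - N%:Z - d by rewrite leNgt; apply: contra h2 => h; rewrite YW0.
    by exists (absz d); lia.
  - by move=> i j _ _ [].
  rewrite (@fsum_ord _ _ _ m.+1 (fun i => (i%:Z, 0))) /=; first last.
  - move=> [d d']; rewrite scaler_eq0 negb_or => /andP [h1 h2].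
    move: h1; rewrite /lift1; case: (d' =P 0) => [d'0|_]; last by rewrite eqxx.
    move=> h1; move: h2; rewrite /Yiter /= => h2.
    have d0 : 0 <= d by rewrite leNgt; apply: contra h1 => h; rewrite poly_exp_lt0.
    have dm : - N%:Z <= m%:Z - N%:Z - d.
      rewrite leNgt; apply: contra h2 => h; rewrite hN //.
      by rewrite (lin0 (lin1 w _)).
    by exists (absz d); [lia | rewrite d'0; congr (_, _); lia].
  - by move=> i j _ _ [].
  by apply: eq_bigr => i _; rewrite subr0.
rewrite hp /subst_exp -fmul_poly_ratio_deg /zmul; case: ltnP => hm.
  apply: fsum_eq0 => a; rewrite /fexp; case e : (m%:Z - N%:Z) => [j|j]; first by lia.
  by rewrite scale0r.
have -> : m%:Z - N%:Z = (m - N)%N%:Z by rewrite subzn.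
by [].
Qed.

(** Y_W(Y(v,z) 1, x) = Y_W(v, x e^z): for the pair v, 1 the product is Y_W(v,x1) alone, already
    finite in each degree, so p = 1 serves as denominator. *)
Lemma YW_creation v w n (j : nat) : YW (Y v one j%:Z) w n = exp_coef n%:~R j *: YW v w n.
Proof.
have [_ _ hcr _ _] := hV.
have hN c : c < - 0%N%:Z -> Y v one c = 0 by apply: hcr.
have hr := rational_pair_YY w n hN.
have hX a : a != n -> deg_part (YY YW v one w) n a = 0.
  move=> han; rewrite /deg_part /YY (phim_one hW) ifF ?YW_arg0 //.
  by apply/negP => /eqP h; move/eqP: han; apply; lia.
have hsup : fin_supp (deg_part (YY YW v one w) n).
  by exists (absz n).+1 => a; have [-> //|/hX ->] := eqVneq a n; rewrite eqxx.
have := @rational_pair_numerator _ _ _ _ _ 1 hr; rewrite -polyC1 !poly_actC !scale1r => /(_ hsup).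
move=> /(congr1 (fun g => g j)); rewrite subr0 => ->.
rewrite /zmul /= subn0 /exp_eval (@fsum_seq _ _ _ [:: n]) //.
  by rewrite big_seq1 /deg_part subrr /YY (phim_one hW) eqxx.
move=> d; rewrite inE; apply: contraR => hd; apply/eqP; rewrite hX ?scaler0 //.
Qed.

(** * The products in the opposite order *)

Section Relation.
Context (u v : V) (r : nat) (u' v' : 'I_r -> V)
  (f : 'I_r -> {fraction {poly K}}) (k : nat) (hrel : T_relation Y u v u' v' f k).

Let B w i := swap (YY YW (v' i) (u' i) w).
Let S w d := \sum_(i < r) fmul (iota_ratio (f i)) (B w i) d.

Lemma trunc21_BW w i : trunc21 (B w i).
Proof.
have [_ _ htr] := phim_map hW; split=> [|a]; last exact: htr.
by have [N hN] := htr (u' i) w; exists N => a b ha; rewrite /B /= hN ?YW_arg0.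
Qed.

Lemma trunc21_S w : trunc21 (S w).
Proof.
apply: trunc21_sum => i; apply: trunc21_fmul; last exact: trunc21_BW.
by have [] := iota_ratioP (f i).
Qed.

(** By [YW_creation] the operator e^(z D) in skew symmetry becomes e^(n z) in degree n. This is
    exactly the factor that [rational_pair_treflect] produces when the order of the two operators is
    exchanged. *)
Lemma rational_pair_S w n : exists N0 : nat, forall N, (N0 <= N)%N ->
  rational_pair N (deg_part (S w) n) (fun i : nat => YW (Y u v (i%:Z - N%:Z)) w n).
Proof.
have [lin1 _ _] := phim_map hW; have [_ _ htr] := wqva_map hV.
have [N1 h1] := skew_symmetry hV hrel.
have [N2 h2] : exists N2, forall N, (N2 <= N)%N -> forall i c, c < - N%:Z -> Y (v' i) (u' i) c =
  0.
  exact: exists_common (fun i => truncated_nat (htr (v' i) (u' i))).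
exists (maxn N1 N2) => N; rewrite geq_max => /andP [/h1 hskew /h2 hN].
apply: (rational_pair_div (common_den_neq0 f)).
pose h i : nat -> W := fun m : nat => YW (Y (v' i) (u' i) (m%:Z - N%:Z)) w n.
pose lam (g : nat -> V) : nat -> W := fun m => YW (g m) w n.
have lamL : linear lam.
  by move=> c x y; apply/funext => m; rewrite /lam lin1.
have lamE x : lam (expmul 1 x) = expmul 1 (lam x).
  apply/funext => m; rewrite /lam /expmul /conv (lin_sum (lin1 w n)).
  by apply: eq_bigr => i _; rewrite (linZ (lin1 w n)).
have -> : poly_act (expmul 1) (common_den f) (fun i : nat => YW (Y u v (i%:Z - N%:Z)) w n)
    = \sum_i poly_act (expmul 1) (cofactor_num f i) (expmul n%:~R (zneg N (h i))).
  rewrite -[X in poly_act _ _ X]/(lam (fun i : nat => Y u v (i%:Z - N%:Z))).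
  rewrite -(poly_act_intertwine (T' := expmul 1) _ _ lamL lamE) hskew (lin_sum lamL).
  apply: eq_bigr => i _; rewrite (poly_act_intertwine _ _ lamL lamE); congr (poly_act _ _ _).
  apply/funext => m; rewrite /lam /diagsum /expmul /conv (lin_sum (lin1 w n)).
  apply: eq_bigr => j _; rewrite (linZ (lin1 w n)) YW_creation /zneg /h !scalerA mulrC.
  by rewrite sign_sub.
have -> : poly_act (@tmul W) (common_den f) (deg_part (S w) n)
    = \sum_i poly_act (@tmul W) (cofactor_num f i) (deg_part (B w i) n).
  have -> : deg_part (S w) n = \sum_i deg_part (fmul (iota_ratio (f i)) (B w i)) n.
    by apply/funext => a; rewrite fct_sumE.
  rewrite (poly_act_sum (@tmul_lin K W)); apply: eq_bigr => i _.
  rewrite (common_denE f i) /cofactor_num !(poly_actM (@tmul_lin K W)); congr (poly_act _ _ _).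
  have [i1 i2] := iota_ratioP (f i).
  rewrite -!fmul_poly_ratio_deg; congr (deg_part _ n); apply/funext => e.
  rewrite (fmulA21 e (trunc21_poly_ratio _) i1 (trunc21_BW w i)) i2.
  by [].
apply: rational_pair_sum => i; apply: rational_pair_mul.
have -> : deg_part (B w i) n = treflect n (deg_part (YY YW (v' i) (u' i) w) n).
  by apply/funext => a; rewrite /treflect /deg_part subKr.
exact: rational_pair_treflect (rational_pair_YY w n (hN i)).
Qed.

End Relation.

(** * Covariance and the commutator formula for a given p *)

Section Covariant.
Context (G : set (V -> V)) (chi : (V -> V) -> K) (hchi : linear_character G chi)
  (hcov : covariant_phi_quasi_module one Y G chi YW)
  (u v : V) (r : nat) (u' v' : 'I_r -> V)
  (f : 'I_r -> {fraction {poly K}}) (k : nat) (hrel : T_relation Y u v u' v' f k).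

Lemma iter_xddx s (X : int * int -> K) a b : iter s xddx X (a, b) = b%:~R ^+ s * X (a, b).
Proof. by elim: s => [|s IH]; rewrite ?mul1r // iterS /= IH exprS mulrA. Qed.

(** The exponential of x0 (x d/dx) scales x by e^(x0), so the coefficient of x1^a in the delta
    function is (chi(g) e^(x0))^(-a) x^(-a). *)
Lemma commutator_termE g w N a b : (forall c, c < - N.+1%:Z -> Y (g u) v c = 0) ->
  Res0 (commutator_term Y YW chi u v g w) (a, b)
  = exp_residue (chi g) N (fun i : nat => YW (Y (g u) v (i%:Z - N.+1%:Z)) w (a + b)) a.
Proof.
move=> hN; have [lin1 _ _] := phim_map hW.
rewrite /Res0 /commutator_term /fmul (@fsum_ord _ _ _ N.+1 (fun s => (s%:Z, a, - a))); first last.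
- move=> [[s a'] b']; rewrite scaler_eq0 negb_or => /andP [h1 h2].
  move: h2; rewrite /lift02 /=; case: (a - a' =P 0) => [ea h2|_]; last by rewrite eqxx.
  move: h1; rewrite /exp_xddx; case: s h2 => [s|s] h2; last by rewrite eqxx.
  rewrite iter_xddx /delta_ratio; case: (a' + b' =P 0) => [eb _|_];
    last by rewrite mulr0 mul0r eqxx.
  exists s; last by congr (_, _, _); lia.
  rewrite ltnNge; apply: contra h2 => hs; rewrite hN; first by rewrite (lin0 (lin1 w _)).
  by lia.
- by move=> i j _ _ [].
rewrite /exp_residue /expmul /conv scaler_sumr; apply: eq_bigr => s _.
rewrite /exp_xddx iter_xddx /delta_ratio subrr eqxx /lift02 /= subrr eqxx scalerA.
rewrite /exp_coef intrN opprK; congr (_ *: YW (Y _ _ _) _ _).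
- by rewrite -mulrA mulrCA.
- by have := ltn_ord s; lia.
- by rewrite addrC.
Qed.

(** By covariance the series A(t) for g u is A(chi(g) t), so the module axiom for g u describes A
    along t = chi(g) e^z. *)
Lemma term_vanish_below p g w n N : G g -> (forall c, c < - N.+1%:Z -> Y (g u) v c = 0) ->
  fin_supp (poly_act (@tmul W) p (deg_part (YY YW u v w) n)) ->
  poly_act (bexpmul (chi g)) p (fun i : nat => YW (Y (g u) v (i%:Z - N.+1%:Z)) w n)
  = zmul N.+1 (exp_eval (dilate (chi g) (poly_act (@tmul W) p (deg_part (YY YW u v w) n)))).
Proof.
move=> Gg hN hs; apply: rational_pair_dilate => //; first exact: (chi_neq0 hchi Gg).
have -> : dilate (chi g) (deg_part (YY YW u v w) n) = deg_part (YY YW (g u) v w) n.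
  by apply/funext => a; rewrite /dilate /deg_part /= (cov_Y hcov).
exact: rational_pair_YY.
Qed.

Lemma commutator_formula p n (g : 'I_n -> V -> V) :
  p != 0 -> (forall w, truncated2 (pYY YW p u v w)) ->
  (forall j, G (g j)) -> injective (fun j => chi (g j)) ->
  (forall z, root p z -> exists j, chi (g j) = z) ->
  forall w e, commutator_lhs YW u v u' v' f w e
    = \sum_(j < n) Res0 (commutator_term Y YW chi u v (g j) w) e.
Proof.
move=> p0 htr Gg ginj groot w [a b].
have [_ _ htrW] := phim_map hW; have [_ _ htrV] := wqva_map hV.
set d := a + b; have eb : b = d - a by rewrite /d addrC addKr.
pose A := deg_part (YY YW u v w) d.
pose S := deg_part (fun d => \sum_(i < r) fmul (iota_ratio (f i)) (swap (YY YW (v' i) (u' i) w))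
  d) d.
have hs : fin_supp (poly_act (@tmul W) p A).
  by rewrite /A -fmul_poly_ratio_deg; exact: (fin_supp_truncated2 d (htr w)).
have Slow : exists L : int, forall a, a < L -> S a = 0.
  by have [[L hL] _] := trunc21_S u' v' f w; exists L => x hx; apply: hL.
have Ahigh : exists L : int, forall a, L <= a -> A a = 0.
  have [M hM] := htrW v w; exists (d - M + 1) => x hx.
  by rewrite /A /deg_part /= hM ?YW_arg0 //; lia.
have [N0 hN0] := rational_pair_S hrel w d.
have [N1 hN1] := truncated_nat (htrV u v).
have r1 := hN0 _ (leq_maxl N0 N1).
have r2 := rational_pair_YY w d (hN1 _ (leq_maxr N0 N1)).
have [q q0 hq] := rational_pair_inj r1 r2.
have lt := @tmul_lin K W.
(* So far only q A = q S is known for some q. Since p A is finite and S bounded below, p A - p S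
   lies where q acts injectively. *)
have AS : poly_act (@tmul W) p A = poly_act (@tmul W) p S.
  apply/eqP; rewrite -subr_eq0; apply/eqP; apply: (tmul_inj q0).
    have [L1 h1] := hs; have [L2 h2] := Slow.
    exists (Num.min (- L1%:Z) L2) => x hx.
    rewrite -[LHS]/(poly_act (@tmul W) p A x - poly_act (@tmul W) p S x).
    have -> : poly_act (@tmul W) p A x = 0.
      by apply/eqP; apply: contraT => /h1; lia.
    rewrite -fmul_pcoef (@fmul_vanish_below _ _ _ _ L2) ?subr0 //; last by lia.
    by case.
  by rewrite (poly_actB lt) !(poly_actC_mul q p) // hq subrr.
have hNN j : exists N : nat, forall c, c < - N.+1%:Z -> Y (g j u) v c = 0.
  by have [N hN] := truncated_nat (htrV (g j u) v); exists N => c hc; apply: (hN N.+1).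
have [N hN] := choice hNN.
have h := @residue_formula K W n (fun j => chi (g j)) p N A S (poly_act (@tmul W) p A)
  (fun j i => YW (Y (g j u) v (i%:Z - (N j).+1%:Z)) w d) ginj
  (fun j => chi_neq0 hchi (Gg j)) p0 groot hs erefl (esym AS) Ahigh Slow
  (fun j => term_vanish_below (Gg j) (hN j) hs) a.
rewrite /commutator_lhs eb -[YY YW u v w _]/(A a) -[\sum_(i < r) _]/(S a) h.
by apply: eq_bigr => j _; rewrite -eb (commutator_termE w a b (hN j)).
Qed.

(** At chi(g) the denominator is invertible, so there is no residue; hence only roots of p
    contribute to a sum over G. *)
Lemma term_eq0 p g : p != 0 -> (forall w, truncated2 (pYY YW p u v w)) ->
  G g -> ~~ root p (chi g) ->
  forall w e, Res0 (commutator_term Y YW chi u v g w) e = 0.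
Proof.
move=> p0 htr Gg hp w [a b]; have [_ _ htrV] := wqva_map hV.
have [N hN] := truncated_nat (htrV (g u) v); have {}hN := hN N.+1 (leqnSn N).
rewrite (commutator_termE w a b hN); apply: exp_residue_vanish_below.
apply: (@poly_act_expmul_vanish_below_inv _ _ 1 p (chi g)); first exact: hp.
have hs : fin_supp (poly_act (@tmul W) p (deg_part (YY YW u v w) (a + b))).
  by rewrite -fmul_poly_ratio_deg; exact: (fin_supp_truncated2 (a + b) (htr w)).
have := term_vanish_below Gg hN hs; rewrite /bexpmul => -> i hi.
by rewrite /zmul hi.
Qed.

End Covariant.

End Module.

Theorem theorem4p19 (R : realType) (V W : lmodType R[i])
    (one : V) (Y : V -> V -> int -> V)
    (hV : weak_quantum_va one Y) (hT : T_type Y)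
    (G : set (V -> V)) (hG : automorphism_group one Y G)
    (chi : (V -> V) -> R[i]) (hchi : linear_character G chi)
    (YW : V -> W -> int -> W)
    (hW : covariant_phi_quasi_module one Y G chi YW)
    (u v : V) (r : nat) (u' v' : 'I_r -> V)
    (f : 'I_r -> {fraction {poly R[i]}})
    (hrel : exists k : nat, T_relation Y u v u' v' f k) :
  (exists (n : nat) (g : 'I_n -> V -> V),
     [/\ forall j, G (g j),
         injective (fun j => chi (g j))
       & forall (w : W) (e : int * int),
           commutator_lhs YW u v u' v' f w e
           = Res0 (fun d => \sum_(j < n) commutator_term Y YW chi u v (g j) w d)
               e])
  /\
  (set_inj G chi ->
     finite_set [set g | G g /\
       exists (w : W) (e : int * int),
         Res0 (commutator_term Y YW chi u v g w) e <> 0]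
     /\ forall (w : W) (e : int * int),
          commutator_lhs YW u v u' v' f w e
          = \sum_(g \in G) Res0 (commutator_term Y YW chi u v g w) e).
Proof.
have [k hk] := hrel; have hM := cov_module hW.
(* This p does not depend on w, so neither do the group elements chosen from its roots. *)
have [p [p0 hroot htr]] := cov_zeros hW u v.
have gex z : exists g, root p z -> G g /\ chi g = z.
  have [rz|nz] := boolP (root p z); last by exists id.
  by have [g Gg cg] := hroot z rz; exists g.
have [gz hgz] := choice gex.
have [rs0 hrs0] := closed_field_poly_normal p.
(* Multiplicities are dropped to make the values chi(g_j) distinct; each residue accounts for the
   full order of its pole. *)
pose rs := undup rs0.
have hrs z : (z \in rs) = root p z.
  by rewrite mem_undup [in RHS]hrs0 rootZ ?lead_coef_eq0 // root_prod_XsubC.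
pose g (j : 'I_(size rs)) := gz rs`_j.
have hj (j : 'I_(size rs)) : root p rs`_j by rewrite -hrs mem_nth.
have Gg j : G (g j) by have [] := hgz _ (hj j).
have cg j : chi (g j) = rs`_j by have [] := hgz _ (hj j).
have ginj : injective (fun j => chi (g j)).
  move=> i j; rewrite !cg => /eqP; rewrite nth_uniq ?undup_uniq // => /eqP.
  exact: val_inj.
have groot z : root p z -> exists j, chi (g j) = z.
  rewrite -hrs => zr; have hi : (index z rs < size rs)%N by rewrite index_mem.
  by exists (Ordinal hi); rewrite cg /= nth_index.
have formula := commutator_formula hV hM hchi hW hk p0 htr Gg ginj groot.
split; first by exists (size rs), g; split=> // w [a b]; rewrite formula.
move=> cinj; pose gs := [seq gz z | z <- rs].
have zero g0 : G g0 -> g0 \notin gs -> forall w e,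
    Res0 (commutator_term Y YW chi u v g0 w) e = 0.
  (* If chi(g0) were a root, injectivity of chi would identify g0 with the element chosen for that
     root. *)
  move=> Gg0 hg0; apply: (term_eq0 hV hM hchi hW p0 htr Gg0).
  apply: contra hg0 => rg; apply/mapP; exists (chi g0); first by rewrite hrs.
  have [Gz cz] := hgz _ rg.
  by apply: cinj; rewrite ?inE // cz.
split.
  apply: (@sub_finite_set _ _ [set` gs]); last exact: finite_seq.
  move=> g0 [Gg0 [w [e h]]] /=; apply: contrapT => /negP hn; apply: h.
  exact: zero.
move=> w e; rewrite formula (fsbigE gs) /=.
- rewrite big_map (big_nth 0) big_mkord; symmetry; rewrite big_mkcond.
  by apply: eq_bigr => j _; rewrite mem_set //; apply: Gg.
- rewrite map_inj_in_uniq ?undup_uniq // => x y; rewrite !hrs => /hgz [_ cx] /hgz [_ cy] e1.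
  by rewrite -cx -cy e1.
- by move=> g0 /= /mapP [z]; rewrite hrs => /hgz [Gz _] ->.
- by move=> g0 Gg0 hg0; apply: zero.
Qed.
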